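(* Let $A$ be a finite dimensional weak $C^*$-Hopf algebra and $M$ an $A$-module algebra. Let $M\rtimes A:=M\otimes_{A_L}A$ as a vector space, i.e. the span of elements $(m\rtimes a)$, $m\in M,a\in A$, modulo $(m\rtimes ba)=(m(b\triangleright1_M)\rtimes a)$ for all $b\in A_L$. Then: (i) $M\rtimes A$ becomes a $*$-algebra with (well defined) multiplication and $*$-structure given for $m,m'\in M$, $a,a'\in A$ by $$(m\rtimes a)(m'\rtimes a')=(m(a_{(1)}\triangleright m')\rtimes a_{(2)}a'),\qquad (m\rtimes a)^*=(1_M\rtimes a^* )(m^*\rtimes1).$$ (ii) For all $m\in M$ and $a\in A$: $((a\triangleright m)\rtimes1)=(1_M\rtimes a_{(1)})(m\rtimes1)(1_M\rtimes S(a_{(2)}))$. (iii) The unit of $M\rtimes A$ is $(1_M\rtimes1)$. Moreover $M\cong(M\rtimes1)\equiv M\otimes_{A_L}A_L$ and $A/I_\triangleright\cong(1_M\rtimes A)\equiv M_R\otimes_{A_L}A$ as unital $*$-subalgebras of $M\rtimes A$, where $I_\triangleright\subset A$ is the two-sided ideal generated by $\ker\mu_\triangleright$. (iv) Put $N:=M^A$ and identify $M\equiv(M\rtimes1)$. Then $$1_M\rtimes A\subset N'\cap(M\rtimes A),\qquad 1_M\rtimes A_R\subset M'\cap(M\rtimes A),$$ $$1_M\rtimes(A_R\cap C(A))\subset C(M\rtimes A),\qquad 1_M\rtimes(A_L\cap A_R\cap C(A))\subset M\cap C(M\rtimes A).$$ (v) $M\cap C(M\rtimes A)=N\cap C(M)=N\cap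 C(M\rtimes A)$.
   Context: A finite dimensional weak $C^*$-Hopf algebra is a finite dimensional $C^*$-algebra $A$ (unit $1$) with linear maps $\Delta:A\to A\otimes A$, $\varepsilon:A\to\mathbb C$, $S:A\to A$ such that, for all $x,y,z\in A$ in Sweedler notation: $\Delta(xy)=\Delta(x)\Delta(y)$; $\Delta(x^* )=\Delta(x)^*$; $(\Delta\otimes\mathrm{id})\Delta=(\mathrm{id}\otimes\Delta)\Delta$; $(\Delta(1)\otimes1)(1\otimes\Delta(1))=1_{(1)}\otimes1_{(2)}\otimes1_{(3)}$; $(\varepsilon\otimes\mathrm{id})\Delta=\mathrm{id}=(\mathrm{id}\otimes\varepsilon)\Delta$; $\varepsilon(xyz)=\varepsilon(xy_{(1)})\varepsilon(y_{(2)}z)$; $S(x_{(1)})x_{(2)}=1_{(1)}\varepsilon(x1_{(2)})$; $x_{(1)}S(x_{(2)})=\varepsilon(1_{(1)}x)1_{(2)}$; $S(x_{(1)})x_{(2)}S(x_{(3)})=S(x)$. ($\Delta(1)\neq 1\otimes 1$ in general; $S$ is automatically invertible.) Put $x_*:=S(x)^*$. $A_L=\{(\varphi\otimes\mathrm{id})(\Delta(1))\}$ and $A_R=\{(\mathrm{id}\otimes\varphi)(\Delta(1))\}$, with $\varphi$ running through the linear functionals on $A$; these are unital $*$-subalgebras of $A$. An $A$-module algebra is a unital $*$-algebra $M$ with a linear left action $\triangleright:A\otimes M\to M$ such that $(ab)\triangleright m=a\triangleright(b\triangleright m)$, $1\triangleright m=m$, $a\triangleright(mn)=(a_{(1)}\triangleright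 m)(a_{(2)}\triangleright n)$, $(a\triangleright m)^*=a_*\triangleright m^*$, $a\triangleright1_M=(a_{(1)}S(a_{(2)}))\triangleright1_M$. Put $M_R:=A\triangleright1_M$, a unital $*$-subalgebra of $M$, and $\mu_\triangleright:A_L\to M_R$, $a\mapsto a\triangleright1_M$, a surjective $*$-homomorphism. In $M\otimes_{A_L}A$, $A_L$ acts on $A$ by left multiplication and on $M$ by right multiplication through $\mu_\triangleright$. The fixed point algebra is $M^A=\{n\in M: a\triangleright n=a_{(1)}S(a_{(2)})\triangleright n\ \forall a\in A\}$, a unital $*$-subalgebra. $C(\cdot)$ denotes the center and $X'\cap Y$ the commutant of $X$ in $Y$. *)

(* Defs.v *)
From HB Require Import structures.
From mathcomp Require Import all_boot all_order all_algebra.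
From mathcomp Require Import ring_quotient boolp classical_sets reals.
From mathcomp Require Import complex.
From mathcomp.multinomials Require Import freeg.

Set Implicit Arguments.
Unset Strict Implicit.
Unset Printing Implicit Defensive.

Import Order.TTheory GRing.Theory Num.Theory.

Local Open Scope classical_set_scope.
Local Open Scope ring_scope.
Local Open Scope quotient_scope.

Section Subspace.
Context {K : nzRingType} {V : lmodType K} (I : submodClosed V).

Definition subspace_pred : {pred V} := I.

Fact subspace_pred_zmod : zmod_closed subspace_pred.
Proof. exact: GRing.submod_closedB (GRing.submodClosedP I). Qed.

HB.instance Definition _ := GRing.isZmodClosed.Build V subspace_pred
  subspace_pred_zmod.
HB.instance Definition _ := GRing.SubmodClosed.on subspace_pred.

Definition subspace : Type := {x : V | x \in subspace_pred}.
HB.instance Definition _ := SubChoice.on subspace.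
HB.instance Definition _ := [SubChoice_isSubZmodule of subspace by <:].
HB.instance Definition _ := [SubZmodule_isSubLmodule of subspace by <:].

End Subspace.

Arguments subspace {K V} I.

Section LinearQuotient.
Context {K : nzRingType} {V : lmodType K} (I : submodClosed V).

Local Notation subspace_pred := (subspace_pred I).

Definition lquot : Type := Quotient.quot subspace_pred.
HB.instance Definition _ := GRing.Zmodule.on lquot.

Definition to_lquot (x : V) : lquot := \pi_(Quotient.quot subspace_pred) x.

Definition lquot_scale (c : K) (q : lquot) : lquot :=
  to_lquot (c *: repr (q : Quotient.quot subspace_pred)).

Lemma to_lquot_eq x y : (to_lquot x = to_lquot y) <-> x - y \in I.
Proof.
have -> : (x - y \in I) = (x == y %[mod Quotient.quot subspace_pred]).
  by rewrite -Quotient.idealrBE.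
by split=> /eqP.
Qed.

Lemma to_lquotD x y : to_lquot (x + y) = to_lquot x + to_lquot y.
Proof. by rewrite /to_lquot piE. Qed.

Lemma to_lquotK q : to_lquot (repr (q : Quotient.quot subspace_pred)) = q.
Proof. exact: reprK. Qed.

Lemma to_lquotZ_subproof c x : to_lquot (c *: x) = lquot_scale c (to_lquot x).
Proof.
apply/to_lquot_eq; rewrite -scalerBr; apply: rpredZ.
by apply/to_lquot_eq; rewrite to_lquotK.
Qed.

Fact lquot_scaleA a b q :
  lquot_scale a (lquot_scale b q) = lquot_scale (a * b) q.
Proof.
by rewrite -[q]to_lquotK -!to_lquotZ_subproof scalerA.
Qed.

Fact lquot_scale1 : left_id 1 lquot_scale.
Proof.
by move=> q; rewrite -[q]to_lquotK -!to_lquotZ_subproof scale1r.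
Qed.

Fact lquot_scaleDr : right_distributive lquot_scale +%R.
Proof.
move=> a p q; rewrite -[p]to_lquotK -[q]to_lquotK -to_lquotD.
by rewrite -!to_lquotZ_subproof scalerDr to_lquotD.
Qed.

Fact lquot_scaleDl q : {morph lquot_scale^~ q : a b / a + b}.
Proof.
move=> a b; rewrite -[q]to_lquotK.
by rewrite -!to_lquotZ_subproof scalerDl to_lquotD.
Qed.

HB.instance Definition _ := GRing.Zmodule_isLmodule.Build K lquot
  lquot_scaleA lquot_scale1 lquot_scaleDr lquot_scaleDl.

Fact to_lquot_is_linear : linear to_lquot.
Proof. by move=> a x y; rewrite to_lquotD to_lquotZ_subproof. Qed.

HB.instance Definition _ := GRing.isLinear.Build K V lquot *:%R to_lquot
  to_lquot_is_linear.

End LinearQuotient.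

Arguments lquot {K V} I.
Arguments to_lquot {K V} I x.

Inductive lin_span {K : nzRingType} {V : lmodType K} (X : set V) : set V :=
| LinSpan0 : lin_span X 0
| LinSpanC c x y : X x -> lin_span X y -> lin_span X (c *: x + y).

Definition span_pred {K : nzRingType} {V : lmodType K} (X : set V) :
  {pred V} := fun x => `[< lin_span X x >].

Fact span_pred_submod {K : nzRingType} {V : lmodType K} (X : set V) :
  submod_closed (span_pred X).
Proof.
split=> [|a x y /asboolP xP /asboolP yP]; first exact/asboolP/LinSpan0.
apply/asboolP; elim: xP => [|c u v Xu _ ih]; first by rewrite scaler0 add0r.
by rewrite scalerDr scalerA -addrA; apply: LinSpanC.
Qed.

HB.instance Definition _ (K : nzRingType) (V : lmodType K) (X : set V) :=
  GRing.isSubmodClosed.Build K V (span_pred X)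
    (GRing.submod_closed_semi (span_pred_submod X)).

(* [tensor G] is the tensor product of V and W over K in which, additionally,  *)
(* v (x) w and v' (x) w' are identified whenever [G v w v' w'] holds: the free *)
(* vector space on V * W modulo the span of the bilinearity and G relations.   *)
Section Tensor.
Context {K : fieldType} {V W : lmodType K} (G : V -> W -> V -> W -> Prop).

Inductive tensor_rel : set {freeg (V * W)%type / K} :=
| TensorDl v v' w :
    tensor_rel (<< (v + v', w) >> - << (v, w) >> - << (v', w) >>)
| TensorDr v w w' :
    tensor_rel (<< (v, w + w') >> - << (v, w) >> - << (v, w') >>)
| TensorZl c v w : tensor_rel (<< (c *: v, w) >> - c *: << (v, w) >>)
| TensorZr c v w : tensor_rel (<< (v, c *: w) >> - c *: << (v, w) >>)
| TensorG v w v' w' of G v w v' w' :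
    tensor_rel (<< (v, w) >> - << (v', w') >>).

Definition tensor := lquot (span_pred tensor_rel).

HB.instance Definition _ := GRing.Lmodule.on tensor.

Definition tpure (v : V) (w : W) : tensor :=
  to_lquot (span_pred tensor_rel) << (v, w) >>.

(* [tlift f] maps sum_i v_i (x) w_i to sum_i f v_i w_i, see [tlift_linear] and *)
(* [tlift_pure]. Scalars are absorbed in the left factor rather than pulled    *)
(* out of [f], so that antilinear [f] are covered as well.                     *)
Definition tlift_free {U : zmodType} (f : V -> W -> U)
    (D : {freeg (V * W)%type / K}) : U :=
  \sum_(z <- dom D) f (coeff z D *: z.1) z.2.

Definition tlift {U : zmodType} (f : V -> W -> U) (t : tensor) : U :=
  tlift_free f (repr (t : Quotient.quot (subspace_pred (span_pred tensor_rel)))).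

Record balanced {U : zmodType} (f : V -> W -> U) : Prop := Balanced {
  balancedDl : forall v v' w, f (v + v') w = f v w + f v' w;
  balancedDr : forall v w w', f v (w + w') = f v w + f v w';
  balancedZ  : forall c v w, f (c *: v) w = f v (c *: w);
  balancedG  : forall c v w v' w', G v w v' w' ->
                 f (c *: v) w = f (c *: v') w' }.

Section Universal.
Context {U : zmodType} (f : V -> W -> U) (fP : balanced f).

Lemma balanced0l w : f 0 w = 0.
Proof. by apply: (addIr (f 0 w)); rewrite -balancedDl // !add0r. Qed.

Lemma balancedNl v w : f (- v) w = - f v w.
Proof. by apply: (addIr (f v w)); rewrite -balancedDl // !addNr balanced0l. Qed.

Lemma tlift_freeE (s : seq (V * W)) D : uniq s -> {subset dom D <= s} ->
  tlift_free f D = \sum_(z <- s) f (coeff z D *: z.1) z.2.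
Proof.
move=> us sub; rewrite [RHS](bigID (mem (dom D))) /= [X in _ + X]big1; last first.
  by move=> z /coeff_outdom ->; rewrite scale0r balanced0l.
rewrite addr0 -big_filter; apply: perm_big; apply: uniq_perm.
- exact: uniq_dom.
- exact: filter_uniq.
move=> z; rewrite mem_filter /=; case zD: (z \in dom D) => //=.
by rewrite sub.
Qed.

Lemma tlift_free_lin a D1 D2 : tlift_free f (a *: D1 + D2) =
  tlift_free (fun v => f (a *: v)) D1 + tlift_free f D2.
Proof.
pose s := undup (dom D1 ++ dom D2).
have us : uniq s by apply: undup_uniq.
have s1 : {subset dom D1 <= s} by move=> z; rewrite mem_undup mem_cat => ->.
have s2 : {subset dom D2 <= s}
  by move=> z; rewrite mem_undup mem_cat orbC => ->.
have s3 : {subset dom (a *: D1 + D2) <= s}.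
  move=> z /domD_subset; rewrite mem_cat => /orP[/domZ_subset|]; [exact: s1|exact: s2].
rewrite (tlift_freeE us s3) (tlift_freeE us s2).
have -> : tlift_free (fun v => f (a *: v)) D1 =
          \sum_(z <- s) f (a *: (coeff z D1 *: z.1)) z.2.
  rewrite /tlift_free [RHS](bigID (mem (dom D1))) /= [X in _ + X]big1; last first.
    by move=> z /coeff_outdom ->; rewrite scale0r scaler0 balanced0l.
  rewrite addr0 -[RHS]big_filter; apply: perm_big; apply: uniq_perm.
  - exact: uniq_dom.
  - exact: filter_uniq.
  move=> z; rewrite mem_filter /=; case zD: (z \in dom D1) => //=.
  by rewrite s1.
rewrite -big_split /=; apply: eq_bigr => z _.
by rewrite coeffD coeffZ scalerDl -scalerA balancedDl.
Qed.

Lemma tlift_freeU z : tlift_free f << z >> = f z.1 z.2.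
Proof. by rewrite /tlift_free domU1 big_seq1 coeffU eqxx mulr1 scale1r. Qed.

End Universal.

Lemma balanced_scale {U : zmodType} (f : V -> W -> U) a :
  balanced f -> balanced (fun v => f (a *: v)).
Proof.
move=> fP; split=> [v v' w|v w w'|c v w|c v w v' w' g].
- by rewrite scalerDr balancedDl.
- by rewrite balancedDr.
- by rewrite scalerA mulrC -scalerA balancedZ.
- by rewrite !scalerA (balancedG fP _ g).
Qed.

Lemma tlift_free_rel {U : zmodType} (f : V -> W -> U) D : balanced f ->
  lin_span tensor_rel D -> tlift_free f D = 0.
Proof.
move=> + DP; elim: DP f => [|c x y xP yP ih] f fP.
  by rewrite /tlift_free dom0 big_nil.
rewrite tlift_free_lin // ih // addr0.
move/(balanced_scale c): fP; move: (fun v => f _) => {f ih yP c y} f fP.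
have LD := tlift_free_lin fP.
have LB D1 D2 : tlift_free f (D1 - D2) = tlift_free f D1 - tlift_free f D2.
  rewrite addrC -scaleN1r LD addrC; congr (_ + _).
  rewrite /tlift_free -sumrN; apply: eq_bigr => z _.
  by rewrite scaleN1r balancedNl.
have LZ c z : tlift_free f (c *: << z >>) = f (c *: z.1) z.2.
  rewrite -[_ *: _]addr0 LD tlift_freeU.
  by rewrite /tlift_free dom0 big_nil addr0.
case: xP => [v v' w|v w w'|b v w|b v w|v w v' w' g]; rewrite !LB ?LZ !tlift_freeU //=.
- by rewrite balancedDl // addrAC addrK subrr.
- by rewrite balancedDr // addrAC addrK subrr.
- by rewrite subrr.
- by rewrite balancedZ // subrr.
- by have := balancedG fP 1 g; rewrite !scale1r => ->; rewrite subrr.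
Qed.

Lemma tlift_quot {U : zmodType} (f : V -> W -> U) D : balanced f ->
  tlift f (to_lquot (span_pred tensor_rel) D) = tlift_free f D.
Proof.
move=> fP; rewrite /tlift; set E := repr _.
have /to_lquot_eq /asboolP EP :
  to_lquot (span_pred tensor_rel) E = to_lquot (span_pred tensor_rel) D.
  exact: to_lquotK.
rewrite -[E](subrK D) -[E - D]scale1r tlift_free_lin //.
rewrite (tlift_free_rel (balanced_scale 1 fP) EP) add0r //.
Qed.

Lemma tlift_pure {U : zmodType} (f : V -> W -> U) v w : balanced f ->
  tlift f (tpure v w) = f v w.
Proof. by move=> fP; rewrite tlift_quot // tlift_freeU. Qed.

Lemma tlift_linear {U : zmodType} (f : V -> W -> U) a t u : balanced f ->
  tlift f (a *: t + u) = tlift (fun v => f (a *: v)) t + tlift f u.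
Proof.
move=> fP; rewrite -[t]to_lquotK -[u]to_lquotK -linearP.
by rewrite !tlift_quot ?tlift_free_lin //; exact: balanced_scale.
Qed.

End Tensor.

Arguments tpure {K V W} G v w.

Definition no_rel {V W : Type} : V -> W -> V -> W -> Prop :=
  fun _ _ _ _ => False.

Notation "V ⊗ W" := (@tensor _ V W no_rel)
  (at level 40, left associativity) : type_scope.
Notation "v ⊗ w" := (tpure no_rel v w)
  (at level 40, left associativity) : ring_scope.

Definition tassoc {K : fieldType} {U V W : lmodType K} :
    (U ⊗ (V ⊗ W))%type -> (U ⊗ V ⊗ W)%type :=
  tlift (fun u => tlift (fun v w => u ⊗ v ⊗ w)).

Definition tmul {K : fieldType} {V W : lmodType K}
    (mulV : V -> V -> V) (mulW : W -> W -> W) (t u : (V ⊗ W)%type) :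
    (V ⊗ W)%type :=
  tlift (fun v w => tlift (fun v' w' => mulV v v' ⊗ mulW w w') u) t.

Record star_algebra_axioms (C : numClosedFieldType) (V : lmodType C)
    (mul : V -> V -> V) (one : V) (star : V -> V) : Prop := StarAlgebraAxioms {
  sa_mulA : associative mul;
  sa_mul1l : left_id one mul;
  sa_mul1r : right_id one mul;
  sa_mulDl : left_distributive mul +%R;
  sa_mulDr : right_distributive mul +%R;
  sa_scaleAl : forall c x y, c *: mul x y = mul (c *: x) y;
  sa_scaleAr : forall c x y, c *: mul x y = mul x (c *: y);
  sa_starD : {morph star : x y / x + y};
  sa_starZ : forall c x, star (c *: x) = c^* *: star x;
  sa_starM : forall x y, star (mul x y) = mul (star y) (star x);
  sa_starK : involutive star }.

(* Unlike for [algType], 1 = 0 is not excluded, so the zero algebra is allowed. *)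
Record starAlg (C : numClosedFieldType) := StarAlg {
  sa_lmod : lmodType C;
  sa_mul : sa_lmod -> sa_lmod -> sa_lmod;
  sa_one : sa_lmod;
  sa_star : sa_lmod -> sa_lmod;
  sa_axioms : star_algebra_axioms sa_mul sa_one sa_star }.

Arguments StarAlg {C sa_lmod sa_mul sa_one sa_star} sa_axioms.

Section StarAlgebra.
Context {C : numClosedFieldType}.
Implicit Types X Y : starAlg C.

Definition sa_sort X : Type := sa_lmod X.
Local Coercion sa_sort : starAlg >-> Sortclass.

HB.instance Definition _ X := GRing.Lmodule.on (sa_sort X).

Definition star {X} (x : X) : X := sa_star x.

HB.instance Definition _ X := GRing.Zmodule_isPzRing.Build (sa_sort X)
  (sa_mulA (sa_axioms X)) (sa_mul1l (sa_axioms X)) (sa_mul1r (sa_axioms X))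
  (sa_mulDl (sa_axioms X)) (sa_mulDr (sa_axioms X)).

Definition tmul2 {X} : (X ⊗ X)%type -> (X ⊗ X)%type -> (X ⊗ X)%type :=
  tmul (fun x y : X => x * y) (fun x y : X => x * y).

Definition tmul3 {X} :
    (X ⊗ X ⊗ X)%type -> (X ⊗ X ⊗ X)%type -> (X ⊗ X ⊗ X)%type :=
  tmul tmul2 (fun x y : X => x * y).

Definition center X : set X := [set x | forall y, x * y = y * x].

Definition commutant {X} (S : set X) : set X :=
  [set x | forall y, S y -> x * y = y * x].

Record unital_star_hom X Y (f : X -> Y) : Prop := UnitalStarHom {
  ush_linear : linear f;
  ush_mul : {morph f : x y / x * y};
  ush_one : f 1 = 1;
  ush_star : {morph f : x / star x} }.

Record two_sided_ideal X (J : set X) : Prop := TwoSidedIdeal {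
  ideal0 : J 0;
  idealD : forall x y, J x -> J y -> J (x + y);
  idealZ : forall c x, J x -> J (c *: x);
  idealMl : forall x y, J y -> J (x * y);
  idealMr : forall x y, J x -> J (x * y) }.

Definition ideal_gen X (S : set X) : set X :=
  [set x | forall J, two_sided_ideal J -> S `<=` J -> J x].

Definition ideal_gen_pred X (S : set X) : {pred X} :=
  fun x => `[< ideal_gen S x >].

Fact ideal_gen_submod X (S : set X) : submod_closed (ideal_gen_pred S).
Proof.
split=> [|c x y /asboolP xP /asboolP yP]; apply/asboolP => J JP SJ.
  exact: ideal0.
by apply: idealD => //; [apply: idealZ => //; exact: xP | exact: yP].
Qed.

HB.instance Definition _ X (S : set X) := GRing.isSubmodClosed.Build C X
  (ideal_gen_pred S) (GRing.submod_closed_semi (ideal_gen_submod S)).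

End StarAlgebra.

Arguments center {C} X _.

Coercion sa_sort : starAlg >-> Sortclass.

(* The norm takes values in C, where [0 <= z] means that z is a nonnegative    *)
(* real. Completeness is automatic in finite dimension.                        *)
Record finCstarAlg (C : numClosedFieldType) := FinCstarAlg {
  ca_alg :> starAlg C;
  ca_dim : nat;
  ca_findim : Vector.axiom ca_dim ca_alg;
  ca_norm : ca_alg -> C;
  ca_norm_ge0 : forall x : ca_alg, 0 <= ca_norm x;
  ca_norm_eq0 : forall x : ca_alg, ca_norm x = 0 -> x = 0;
  ca_normD : forall x y : ca_alg, ca_norm (x + y) <= ca_norm x + ca_norm y;
  ca_normZ : forall (c : C) (x : ca_alg), ca_norm (c *: x) = `|c| * ca_norm x;
  ca_normM : forall x y : ca_alg, ca_norm (x * y) <= ca_norm x * ca_norm y;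
  ca_norm_star : forall x : ca_alg, ca_norm (star x * x) = ca_norm x ^+ 2 }.

(* An expression such as f x_(1) x_(2) is written [tlift f (comul x)]. The     *)
(* reassociation [tassoc] makes both sides of [comulA], [comul1] land in       *)
(* (A (x) A) (x) A.                                                            *)
Record weakHopf (C : numClosedFieldType) (A : finCstarAlg C) := WeakHopf {
  comul : {linear A -> (A ⊗ A)%type};
  counit : {scalar A};
  antipode : {linear A -> A};
  comulM : forall x y : A, comul (x * y) = tmul2 (comul x) (comul y);
  comul_star : forall x : A,
    comul (star x) = tlift (fun a b : A => star a ⊗ star b) (comul x);
  comulA : forall x : A, tlift (fun a b : A => comul a ⊗ b) (comul x) =
    tassoc (tlift (fun a b : A => a ⊗ comul b) (comul x));
  comul1 : tmul3 (comul 1 ⊗ (1 : A)) (tassoc ((1 : A) ⊗ comul 1)) =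
    tlift (fun a b : A => comul a ⊗ b) (comul 1);
  counitl : forall x : A, tlift (fun a b : A => counit a *: b) (comul x) = x;
  counitr : forall x : A, tlift (fun a b : A => counit b *: a) (comul x) = x;
  counitM : forall x y z : A, counit (x * y * z) =
    tlift (fun a b : A => counit (x * a) * counit (b * z)) (comul y);
  antipodel : forall x : A, tlift (fun a b : A => antipode a * b) (comul x) =
    tlift (fun a b : A => counit (x * b) *: a) (comul 1);
  antipoder : forall x : A, tlift (fun a b : A => a * antipode b) (comul x) =
    tlift (fun a b : A => counit (a * x) *: b) (comul 1);
  antipode3 : forall x : A,
    tlift (fun (t : (A ⊗ A)%type) (c : A) =>
        tlift (fun a b : A => antipode a * b * antipode c) t)
      (tlift (fun a b : A => comul a ⊗ b) (comul x)) = antipode x }.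

Section WeakHopf.
Context {C : numClosedFieldType} {A : finCstarAlg C} (H : weakHopf A).

Definition lowerstar (a : A) : A := star (antipode H a).

(* a_(1) S(a_(2)) *)
Definition mul_antipode (a : A) : A :=
  tlift (fun a1 a2 : A => a1 * antipode H a2) (comul H a).

Definition AL : set A := [set x | exists phi : {scalar A},
  x = tlift (fun a b : A => phi a *: b) (comul H 1)].

Definition AR : set A := [set x | exists phi : {scalar A},
  x = tlift (fun a b : A => phi b *: a) (comul H 1)].

Definition AL_pred : {pred A} := fun x => `[< AL x >].

Fact AL_submod : submod_closed AL_pred.
Proof.
split=> [|c x y /asboolP [phi ->] /asboolP [psi ->]]; apply/asboolP.
  exists (\0 : {scalar A}); rewrite /tlift /tlift_free big1 // => z _.
  by rewrite scale0r.
pose f (z : A) : C := c * phi z + psi z.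
have fP : scalar f.
  move=> d u v; rewrite /f !linearP /= mulrDr addrACA; congr (_ + _).
  by rewrite mulrDr mulrCA.
pose F : {scalar A} := HB.pack f (GRing.isLinear.Build C A C *%R f fP).
exists F.
rewrite /tlift /tlift_free scaler_sumr -big_split; apply: eq_bigr => z _ /=.
by rewrite scalerDl -scalerA.
Qed.

HB.instance Definition _ := GRing.isSubmodClosed.Build C A AL_pred
  (GRing.submod_closed_semi AL_submod).

End WeakHopf.

Record moduleAlg (C : numClosedFieldType) (A : finCstarAlg C) (H : weakHopf A)
    (M : starAlg C) := ModuleAlg {
  action :> A -> M -> M;
  action_linearl : forall m : M, linear (action^~ m);
  action_linearr : forall a : A, linear (action a);
  actionM : forall (a b : A) (m : M), action (a * b) m = action a (action b m);
  action1 : forall m : M, action 1 m = m;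
  action_mul : forall (a : A) (m n : M), action a (m * n) =
    tlift (fun a1 a2 : A => action a1 m * action a2 n) (comul H a);
  action_star : forall (a : A) (m : M),
    star (action a m) = action (lowerstar H a) (star m);
  action_unit : forall a : A, action a 1 = action (mul_antipode H a) 1 }.

Section Crossed.
Context {C : numClosedFieldType} {A : finCstarAlg C} {H : weakHopf A}.
Context {M : starAlg C} (act : moduleAlg H M).

Definition MR : set M := [set m | exists a : A, m = act a 1].

Definition MR_pred : {pred M} := fun m => `[< MR m >].

Fact MR_submod : submod_closed MR_pred.
Proof.
split=> [|c x y /asboolP [a ->] /asboolP [b ->]]; apply/asboolP.
  exists 0; have /eqP := action_linearl act 1 (-1) 0 0.
  by rewrite scaler0 addr0 scaleN1r addNr => /eqP.
by exists (c *: a + b); rewrite (action_linearl act 1).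
Qed.

HB.instance Definition _ := GRing.isSubmodClosed.Build C M MR_pred
  (GRing.submod_closed_semi MR_submod).

Definition fixed_points : set M :=
  [set n | forall a : A, act a n = act (mul_antipode H a) n].

Definition ker_mu : set A := [set b | AL H b /\ act b 1 = 0].

Definition A_mod_ker : lmodType C := lquot (ideal_gen_pred ker_mu).

Definition to_A_mod_ker (a : A) : A_mod_ker :=
  to_lquot (ideal_gen_pred ker_mu) a.

(* m (x) b a' ~ m (b |> 1_M) (x) a' for b in A_L                               *)
Definition AL_rel (m : M) (a : A) (m' : M) (a' : A) : Prop :=
  exists b : A, [/\ AL H b, a = b * a' & m' = m * act b 1].

Definition crossed : lmodType C := tensor AL_rel.

Definition crossed_pure (m : M) (a : A) : crossed := tpure AL_rel m a.

Definition tensor_M_AL : lmodType C :=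
  tensor (fun (m : M) (x : subspace (AL_pred H)) m' x' =>
            AL_rel m (val x) m' (val x')).

Definition tensor_M_AL_pure (m : M) (x : subspace (AL_pred H)) : tensor_M_AL :=
  tpure _ m x.

Definition tensor_MR_A : lmodType C :=
  tensor (fun (x : subspace MR_pred) (a : A) x' a' =>
            AL_rel (val x) a (val x') a').

Definition tensor_MR_A_pure (x : subspace MR_pred) (a : A) : tensor_MR_A :=
  tpure _ x a.

End Crossed.

(* Main.v *)
(* Write m # a for the class of m (x) a. The multiplication is dictated by the *)
(* commutation rule (1 # a)(m # 1) = (a_(1) |> m) # a_(2). What makes it work  *)
(* is the counital calculus of A: Delta(l) = l 1_(1) (x) 1_(2) =               *)
(* 1_(1) l (x) 1_(2) for l in A_L, and dually for A_R; A_L and A_R commute; S  *)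
(* is antimultiplicative, exchanges A_L and A_R, and S(S(x)^* )^* = x. Hence   *)
(* l |> m = (l |> 1) m on A_L and r |> m = m (r |> 1) on A_R, so the product   *)
(* and the star are well defined. M embeds because m # a |-> m (a |> 1) is     *)
(* well defined. For A / I one uses the separability idempotent                *)
(* S(1_(1)) (x) 1_(2) of A_L: the map m # a |-> m (S(1_(1)) |> 1) (x) 1_(2) a  *)
(* into M (x) A is well defined, so if 1 # a = 0, expanding 1_(2) a in a basis *)
(* exhibits a = S(1_(1)) 1_(2) a as an element of the ideal generated by the   *)
(* kernel of mu. Finally, by (ii), a central m satisfies                       *)
(* a |> m = m (a_(1) S(a_(2)) |> 1), which puts it in M^A.                     *)
From HB Require Import structures.
Require Import Defs.
From mathcomp Require Import all_boot all_order all_algebra.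
From mathcomp Require Import ring_quotient boolp classical_sets reals complex.
From mathcomp.multinomials Require Import freeg.
Import GRing.Theory Num.Theory.

Set Implicit Arguments.
Unset Strict Implicit.
Unset Printing Implicit Defensive.

Local Open Scope classical_set_scope.
Local Open Scope ring_scope.

(** * Linear maps and tensor products *)

(** Identities between tensors are tested against arbitrary bilinear or trilinear maps: [sw H f x]
    stands for f x_(1) x_(2), and the axioms of A become rewrite rules for such sums ([sw_mul],
    [sw_assoc], [sw1_mid]).

    The legs of Delta(1) give A_R and A_L. The axiom on (Delta(1) ⊗ 1)(1 ⊗ Delta(1)), together with
    its image under the star, computes the coproduct on these subalgebras ([sw_ALl], [sw_ALr],
    [sw_ARl], [sw_ARr]) and makes them commute ([AL_AR_comm]). Hence elements of A_L slide through
    the product ([crossed_mul_balancedr], [crossed_mul_balancedl]). For the star to be well defined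
    one also needs the inverse x |-> star (S (star x)) of the antipode ([antipode_costar]), which
    rests on [antipodeM]; that the star reverses products comes from the cancellation
    [sw_costar_mid].

    The kernel of a |-> 1 # a is computed in [iA_eq0] and [ideal_gen_ker]; both descriptions of the
    copy of A follow. Commutants and centers come from [act_fixed], by which fixed points commute
    with A, and [iM_center]. *)

Definition lin {K : nzRingType} {U V : lmodType K} (f : U -> V) : Prop :=
  forall c x y, f (c *: x + y) = c *: f x + f y.

Definition bil {K : nzRingType} {U V W : lmodType K} (f : U -> V -> W) : Prop :=
  (forall v, lin (fun u => f u v)) /\ (forall u, lin (fun v => f u v)).

Section Lin.
Context {K : nzRingType} {U V W : lmodType K}.

Lemma linD (f : U -> V) x y : lin f -> f (x + y) = f x + f y.
Proof. by move=> /(_ 1 x y); rewrite !scale1r. Qed.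

Lemma lin0 (f : U -> V) : lin f -> f 0 = 0.
Proof. by move=> fL; apply: (addIr (f 0)); rewrite -linD // !add0r. Qed.

Lemma linZ (f : U -> V) c x : lin f -> f (c *: x) = c *: f x.
Proof. by move=> fL; rewrite -[c *: x]addr0 fL lin0 // addr0. Qed.

Lemma lin_sum (f : U -> V) I (r : seq I) (P : pred I) (F : I -> U) : lin f ->
  f (\sum_(i <- r | P i) F i) = \sum_(i <- r | P i) f (F i).
Proof.
by move=> fL; apply: (big_morph f) => [x y|]; [exact: linD | exact: lin0].
Qed.

Lemma lin_id : lin (fun u : U => u).
Proof. by []. Qed.

Lemma lin_linear (g : {linear V -> W}) (f : U -> V) :
  lin f -> lin (fun u => g (f u)).
Proof. by move=> fL c x y; rewrite fL linearP. Qed.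

Lemma lin_comp (g : V -> W) (f : U -> V) :
  lin g -> lin f -> lin (fun u => g (f u)).
Proof. by move=> gL fL c x y; rewrite fL gL. Qed.

Lemma lin_bill {T : lmodType K} (f : U -> V -> W) (g : T -> U) v :
  bil f -> lin g -> lin (fun t => f (g t) v).
Proof. by move=> [fl _] gL c x y; rewrite gL (fl v). Qed.

Lemma lin_bilr {T : lmodType K} (f : U -> V -> W) (g : T -> V) u :
  bil f -> lin g -> lin (fun t => f u (g t)).
Proof. by move=> [_ fr] gL c x y; rewrite gL (fr u). Qed.

End Lin.

Lemma lin_scale {K : fieldType} {U V : lmodType K} c (f : U -> V) :
  lin f -> lin (fun u => c *: f u).
Proof. by move=> fL d x y; rewrite fL scalerDr !scalerA mulrC. Qed.

Lemma lin_scalar {K : nzRingType} {U V W : lmodType K} (phi : {scalar V})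
  (f : U -> V) (w : W) : lin f -> lin (fun u => phi (f u) *: w).
Proof. by move=> fL d x y; rewrite fL linearP scalerDl scalerA. Qed.

Section TensorLemmas.
Context {K : fieldType} {V W : lmodType K} {G : V -> W -> V -> W -> Prop}.
Implicit Types (U : lmodType K) (t : tensor G).

Lemma tpure_rel (D E : {freeg (V * W)%type / K}) : tensor_rel G (D - E) ->
  to_lquot (span_pred (tensor_rel G)) D = to_lquot (span_pred (tensor_rel G)) E.
Proof.
move=> rDE; apply/to_lquot_eq/asboolP.
by rewrite -[D - E]addr0 -[D - E]scale1r; apply: LinSpanC => //; apply: LinSpan0.
Qed.

Lemma tpureDl v v' w : tpure G (v + v') w = tpure G v w + tpure G v' w.
Proof.
by rewrite -to_lquotD; apply: tpure_rel; rewrite opprD addrA; exact: TensorDl.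
Qed.

Lemma tpureDr v w w' : tpure G v (w + w') = tpure G v w + tpure G v w'.
Proof.
by rewrite -to_lquotD; apply: tpure_rel; rewrite opprD addrA; exact: TensorDr.
Qed.

Lemma tpureZl c v w : tpure G (c *: v) w = c *: tpure G v w.
Proof. by rewrite -linearZ; apply: tpure_rel; exact: TensorZl. Qed.

Lemma tpureZr c v w : tpure G v (c *: w) = c *: tpure G v w.
Proof. by rewrite -linearZ; apply: tpure_rel; exact: TensorZr. Qed.

Lemma tpureG v w v' w' : G v w v' w' -> tpure G v w = tpure G v' w'.
Proof. by move=> g; apply: tpure_rel; exact: TensorG. Qed.

Lemma bil_tpure : bil (tpure G).
Proof.
by split=> [w|v] c x y; rewrite (tpureDl, tpureDr) (tpureZl, tpureZr).
Qed.

Lemma balanced_tpure : balanced G (tpure G).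
Proof.
split=> [v v' w|v w w'|c v w|c v w v' w' g].
- exact: tpureDl.
- exact: tpureDr.
- by rewrite tpureZl tpureZr.
- by rewrite !tpureZl (tpureG g).
Qed.

Lemma balanced_bil U (f : V -> W -> U) : bil f ->
  (forall v w v' w', G v w v' w' -> f v w = f v' w') -> balanced G f.
Proof.
move=> [fl fr] fG; split=> [v v' w|v w w'|c v w|c v w v' w' g].
- exact: (linD v v' (fl w)).
- exact: linD.
- by rewrite (linZ c v (fl w)) linZ.
- by rewrite (linZ c v (fl w)) (linZ c v' (fl w')) (fG _ _ _ _ g).
Qed.

Lemma tliftD (U : zmodType) (f : V -> W -> U) t u : balanced G f ->
  tlift f (t + u) = tlift f t + tlift f u.
Proof.
move=> fP; rewrite -[t]scale1r tlift_linear // scale1r; congr (_ + _).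
by congr tlift; apply: funext => v; rewrite scale1r.
Qed.

Lemma tlift0 (U : zmodType) (f : V -> W -> U) : balanced G f ->
  tlift f (0 : tensor G) = 0.
Proof.
by move=> fP; apply: (addIr (tlift f (0 : tensor G))); rewrite -tliftD // !add0r.
Qed.

Lemma tliftZ (U : zmodType) (f : V -> W -> U) c t : balanced G f ->
  tlift f (c *: t) = tlift (fun v => f (c *: v)) t.
Proof. by move=> fP; rewrite -[c *: t]addr0 tlift_linear // tlift0 // addr0. Qed.

Lemma tlift_sum (U : zmodType) (f : V -> W -> U) I (r : seq I) (P : pred I)
    (F : I -> tensor G) : balanced G f ->
  tlift f (\sum_(i <- r | P i) F i) = \sum_(i <- r | P i) tlift f (F i).
Proof.
move=> fP; apply: (big_morph (tlift f)) => [t u|]; [exact: tliftD|exact: tlift0].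
Qed.

(** A chosen finite expansion into pure tensors, with the scalars absorbed on the left. It turns
    every [tlift] into an ordinary finite sum, even for maps that are not balanced ([tliftE]), so
    sums can be exchanged and compared termwise. *)
Definition tdecomp t : seq (V * W) :=
  let D := repr (t : Quotient.quot (subspace_pred (span_pred (tensor_rel G)))) in
  [seq (coeff z D *: z.1, z.2) | z <- dom D].

Lemma tliftE (U : zmodType) (f : V -> W -> U) t :
  tlift f t = \sum_(z <- tdecomp t) f z.1 z.2.
Proof. by rewrite big_map. Qed.

Lemma tlift_tpure t : tlift (tpure G) t = t.
Proof.
rewrite -[t in LHS]to_lquotK tlift_quot; last exact: balanced_tpure.
set D := repr _; rewrite /tlift_free.
transitivity (to_lquot (span_pred (tensor_rel G)) D); last exact: to_lquotK.
rewrite -[D in RHS]freeg_sumE (raddf_sum (to_lquot _)); apply: eq_bigr => z _.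
rewrite tpureZl -linearZ; congr to_lquot.
by apply/eqP/freeg_eqP=> x; rewrite coeffZ !coeffU mul1r -surjective_pairing.
Qed.

Lemma tensorE t : t = \sum_(z <- tdecomp t) tpure G z.1 z.2.
Proof. by rewrite -tliftE tlift_tpure. Qed.

Lemma tensor_ind (P : tensor G -> Prop) :
  (forall t u, P t -> P u -> P (t + u)) -> (forall v w, P (tpure G v w)) ->
  forall t, P t.
Proof.
move=> PD Ppure t; rewrite [t]tensorE.
elim/big_ind: _ => //.
by have -> : 0 = tpure G 0 0 by rewrite -[X in tpure G X _](scale0r 0) tpureZl scale0r.
Qed.

Lemma lin_tlift U (f : V -> W -> U) : balanced G f ->
  (forall w, lin (fun v => f v w)) -> lin (tlift f : tensor G -> U).
Proof.
move=> fP fL c t u; rewrite tlift_linear //; congr (_ + _).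
by rewrite !tliftE scaler_sumr; apply: eq_bigr => z _; rewrite (linZ _ _ (fL _)).
Qed.

End TensorLemmas.

Lemma balanced_no_rel {K : fieldType} {V W U : lmodType K} (f : V -> W -> U) :
  bil f -> balanced no_rel f.
Proof. by move=> fB; apply: balanced_bil. Qed.

Lemma tlift_tlift {K : fieldType} {V W V' W' : lmodType K}
    {G : V -> W -> V -> W -> Prop} {G' : V' -> W' -> V' -> W' -> Prop}
    {U : zmodType} (f : V' -> W' -> U) (g : V -> W -> tensor G') (t : tensor G) :
  balanced G' f -> tlift f (tlift g t) = tlift (fun v w => tlift f (g v w)) t.
Proof. by move=> fP; rewrite (tliftE g) tlift_sum // [RHS]tliftE. Qed.

Lemma eq_tlift {K : fieldType} {V W : lmodType K}
    {G : V -> W -> V -> W -> Prop} {U : zmodType} (f g : V -> W -> U)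
    (t : tensor G) :
  (forall v w, f v w = g v w) -> tlift f t = tlift g t.
Proof. by move=> fg; rewrite !tliftE; apply: eq_bigr. Qed.

Lemma lin_tliftr {K : fieldType} {V W U U' : lmodType K}
    {G : V -> W -> V -> W -> Prop} (F : U -> V -> W -> U') (t : tensor G) :
  (forall v w, lin (fun u => F u v w)) -> lin (fun u => tlift (F u) t).
Proof.
move=> FL c x y; rewrite !tliftE scaler_sumr -big_split.
by apply: eq_bigr => z _; apply: FL.
Qed.

(** * Sweedler sums *)

Section StarAlgLemmas.
Context {C : numClosedFieldType} {X : starAlg C}.
Implicit Types x y : X.

Lemma sa_scalerAl c x y : c *: (x * y) = (c *: x) * y.
Proof. exact: sa_scaleAl (sa_axioms X) c x y. Qed.

Lemma sa_scalerAr c x y : c *: (x * y) = x * (c *: y).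
Proof. exact: sa_scaleAr (sa_axioms X) c x y. Qed.

Lemma starD x y : star (x + y) = star x + star y.
Proof. exact: sa_starD (sa_axioms X) x y. Qed.

Lemma starZ c x : star (c *: x) = c^* *: star x.
Proof. exact: sa_starZ (sa_axioms X) c x. Qed.

Lemma starM x y : star (x * y) = star y * star x.
Proof. exact: sa_starM (sa_axioms X) x y. Qed.

Lemma starK x : star (star x) = x.
Proof. exact: sa_starK (sa_axioms X) x. Qed.

Lemma star1 : star (1 : X) = 1.
Proof. by rewrite -[LHS]mulr1 -[X in _ * X]starK -starM mulr1 starK. Qed.

Lemma star0 : star (0 : X) = 0.
Proof. by apply: (addIr (star 0)); rewrite -starD !add0r. Qed.

Lemma lin_mulr (U : lmodType C) (f : U -> X) y :
  lin f -> lin (fun u => f u * y).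
Proof. by move=> fL c u v; rewrite fL mulrDl sa_scalerAl. Qed.

Lemma lin_mull (U : lmodType C) (f : U -> X) y :
  lin f -> lin (fun u => y * f u).
Proof. by move=> fL c u v; rewrite fL mulrDr sa_scalerAr. Qed.

End StarAlgLemmas.

Section Sweedler.
Context {C : numClosedFieldType} {A : finCstarAlg C} (H : weakHopf A).

(* f x_(1) x_(2) *)
Definition sw {U : zmodType} (f : A -> A -> U) (x : A) : U := tlift f (comul H x).

Lemma swE {U : zmodType} (f : A -> A -> U) x :
  sw f x = \sum_(z <- tdecomp (comul H x)) f z.1 z.2.
Proof. exact: tliftE. Qed.

Lemma eq_sw {U : zmodType} (f g : A -> A -> U) x :
  (forall a b, f a b = g a b) -> sw f x = sw g x.
Proof. by move=> fg; rewrite !swE; apply: eq_bigr => z _. Qed.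

Lemma sw_morph {U V : zmodType} (h : U -> V) (f : A -> A -> U) x :
  h 0 = 0 -> {morph h : u v / u + v} ->
  h (sw f x) = sw (fun a b => h (f a b)) x.
Proof. by move=> h0 hD; rewrite !swE (big_morph h hD h0). Qed.

Lemma lin_swr {U V : lmodType C} (h : U -> V) (f : A -> A -> U) x :
  lin h -> h (sw f x) = sw (fun a b => h (f a b)) x.
Proof. by move=> hL; apply: sw_morph; [exact: lin0|move=> ? ?; exact: linD]. Qed.

Lemma lin_sw {U V : lmodType C} (F : U -> A -> A -> V) x :
  (forall a b, lin (fun u => F u a b)) -> lin (fun u => sw (F u) x).
Proof. exact: lin_tliftr. Qed.

Lemma lin_sw_arg {U V : lmodType C} (f : A -> A -> V) (g : U -> A) :
  bil f -> lin g -> lin (fun u => sw f (g u)).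
Proof.
move=> fB gL c u v; rewrite /sw gL linearP.
by apply: lin_tlift; [exact: balanced_no_rel | case: fB].
Qed.

Lemma sw_exchange {U : zmodType} (F : A -> A -> A -> A -> U) x y :
  sw (fun a b => sw (fun c d => F a b c d) y) x =
  sw (fun c d => sw (fun a b => F a b c d) x) y.
Proof.
under eq_sw do rewrite swE.
by rewrite swE exchange_big swE; apply: eq_bigr => z _; rewrite swE.
Qed.

Lemma lin_antipode {U : lmodType C} (f : U -> A) :
  lin f -> lin (fun u => antipode H (f u)).
Proof. exact: lin_linear. Qed.

Lemma lin_counit {U V : lmodType C} (f : U -> A) (v : V) :
  lin f -> lin (fun u => counit H (f u) *: v).
Proof. exact: lin_scalar. Qed.

End Sweedler.

Reserved Notation "\sw_ ( a , b <- x ) F" (at level 36, F at level 36,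
  a name, b name, format "'[' \sw_ ( a ,  b  <-  x ) '/  '  F ']'").

(** A hook for [lin], rebound later so that the tactic also sees through the counital maps, the
    action and the crossed product. *)
Ltac lin_hook := fail.

Ltac lin :=
  repeat first
    [ assumption
    | exact: lin_id
    | split; intros; cbv beta
    | apply: lin_bill; [eassumption|]
    | apply: lin_bilr; [eassumption|]
    | apply: lin_mulr
    | apply: lin_mull
    | apply: lin_antipode
    | apply: lin_counit
    | lin_hook
    | apply: lin_scale
    | apply: lin_scalar
    | apply: lin_sw; intros; cbv beta
    | apply: lin_sw_arg ].

Definition tri {K : nzRingType} {U V W T : lmodType K} (F : U -> V -> W -> T) :=
  [/\ forall v w, lin (fun u => F u v w), forall u w, lin (fun v => F u v w)
    & forall u v, lin (fun w => F u v w)].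

Lemma balanced_assoc {K : fieldType} {U V W : lmodType K} :
  balanced no_rel (fun (u : U) (t : (V ⊗ W)%type) =>
    tlift (fun (v : V) (w : W) => u ⊗ v ⊗ w) t).
Proof.
apply: balanced_no_rel; split=> [t|u].
  by apply: lin_tliftr => v w c x y; rewrite !(tpureDl, tpureZl).
have uB : bil (fun (v : V) (w : W) => u ⊗ v ⊗ w).
  by split=> [w|v] c x y; rewrite !(tpureDr, tpureZr, tpureDl, tpureZl).
by apply: lin_tlift; [exact: balanced_no_rel | case: uB].
Qed.

Section TensorMul.
Context {C : numClosedFieldType} {A : starAlg C}.

Lemma bil_mul2 a b : bil (fun a' b' : A => (a * a') ⊗ (b * b')).
Proof.
by split=> v c u w; rewrite mulrDr -sa_scalerAr;
  rewrite (tpureDl, tpureDr) (tpureZl, tpureZr).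
Qed.

Lemma lin_tmul2r (t : (A ⊗ A)%type) : lin (tmul2 t).
Proof.
apply: lin_tliftr => a b.
by apply: lin_tlift; [exact: balanced_no_rel (bil_mul2 a b)|case: (bil_mul2 a b)].
Qed.

Lemma lin_tmul2l (t : (A ⊗ A)%type) : lin (fun u => tmul2 u t).
Proof.
have mB : bil (fun a b : A => tlift (fun a' b' => (a * a') ⊗ (b * b')) t).
  split=> [b|a]; apply: lin_tliftr => a' b' c u v; rewrite mulrDl -sa_scalerAl.
    by rewrite tpureDl tpureZl.
  by rewrite tpureDr tpureZr.
by apply: lin_tlift; [exact: balanced_no_rel | case: mB].
Qed.

End TensorMul.

(** * The weak Hopf axioms as rules for Sweedler sums *)

Section BalancedRules.
Context {C : numClosedFieldType} {A : finCstarAlg C} (H : weakHopf A).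
Local Notation "\sw_ ( a , b <- x ) F" := (sw H (fun a b => F) x).
Context {U : zmodType}.
Implicit Types (f : A -> A -> U) (F : A -> A -> A -> U) (x y z : A).

Definition balanced3 F : Prop :=
  (forall c, balanced no_rel (fun a b => F a b c)) /\
  (forall a, balanced no_rel (F a)).

Lemma balanced3_tlift F : balanced3 F ->
  balanced no_rel (fun (t : (A ⊗ A)%type) c => tlift (fun a b => F a b c) t).
Proof.
move=> [F1 F2]; split=> // [t u c|t c d|k t c].
- exact: tliftD.
- rewrite !tliftE -big_split; apply: eq_bigr => z _ /=.
  by rewrite (balancedDr (F2 _)).
- rewrite tliftZ //.
  apply: eq_tlift => a b.
  by rewrite (balancedZ (F1 c)) (balancedZ (F2 a)).
Qed.

Lemma sw_mul_balanced f x y : balanced no_rel f ->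
  sw H f (x * y) = \sw_(a, b <- x) \sw_(c, d <- y) f (a * c) (b * d).
Proof.
move=> fB; rewrite {1}/sw comulM /tmul2 /tmul tlift_tlift //.
by apply: eq_tlift => a b; rewrite tlift_tlift //; apply: eq_tlift => c d;
   rewrite tlift_pure.
Qed.

Lemma tlift_comul F x : balanced3 F ->
  tlift (fun (t : (A ⊗ A)%type) c => tlift (fun a b => F a b c) t)
    (tlift (fun a b : A => comul H a ⊗ b) (comul H x)) =
  \sw_(a, b <- x) \sw_(c, d <- a) F c d b.
Proof.
move=> /balanced3_tlift FB; rewrite tlift_tlift //.
by apply: eq_tlift => a b; rewrite tlift_pure.
Qed.

Lemma tlift_tassoc F a x : balanced3 F ->
  tlift (fun (t : (A ⊗ A)%type) c => tlift (fun a b => F a b c) t)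
    (tassoc (a ⊗ comul H x)) = sw H (F a) x.
Proof.
move=> FT; have FB := balanced3_tlift FT.
have aB := @balanced_assoc C A A A.
rewrite /tassoc (tlift_pure _ _ aB) (tlift_tlift _ _ FB).
apply: eq_tlift => c d; rewrite (tlift_pure _ _ FB).
by rewrite tlift_pure //; case: FT.
Qed.

Lemma sw_assoc_balanced F x : balanced3 F ->
  \sw_(a, b <- x) \sw_(c, d <- a) F c d b =
  \sw_(a, b <- x) \sw_(c, d <- b) F a c d.
Proof.
move=> FT; have FB := balanced3_tlift FT.
have aB := @balanced_assoc C A A A.
rewrite -tlift_comul // comulA {1}/tassoc (tlift_tlift _ _ aB).
by rewrite (tlift_tlift _ _ FB); apply: eq_tlift => a b; exact: tlift_tassoc.
Qed.

Lemma sw_star_balanced f x : balanced no_rel f ->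
  sw H f (star x) = \sw_(a, b <- x) f (star a) (star b).
Proof.
move=> fB; rewrite {1}/sw comul_star tlift_tlift //.
by apply: eq_tlift => a b; rewrite tlift_pure.
Qed.

(** The axiom on (Delta(1) ⊗ 1)(1 ⊗ Delta(1)), evaluated by [F]: the middle leg is the product of
    the second leg of one copy of Delta(1) and the first leg of the other. *)
Lemma sw1_mid_balanced F : balanced3 F ->
  \sw_(a, b <- 1) \sw_(c, d <- 1) F a (b * c) d =
  \sw_(a, b <- 1) \sw_(c, d <- a) F c d b.
Proof.
move=> FT; have FB := balanced3_tlift FT.
have aB := @balanced_assoc C A A A.
rewrite -tlift_comul // -comul1 /tmul3 {1}/tmul tlift_pure; last first.
  apply: balanced_no_rel; split=> [a|t].
    apply: lin_tliftr => t' b c u v.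
    by rewrite lin_tmul2l tpureDl tpureZl.
  by apply: lin_tliftr => t' b c u v; rewrite mulrDl -sa_scalerAl tpureDr tpureZr.
have tB : balanced no_rel
    (fun (t : (A ⊗ A)%type) (b : A) => tmul2 (comul H 1) t ⊗ (1 * b)).
  apply: balanced_no_rel; split=> [a|t] c u v.
    by rewrite lin_tmul2r tpureDl tpureZl.
  by rewrite mulrDr -sa_scalerAr tpureDr tpureZr.
rewrite /tassoc (tlift_pure _ _ aB) (tlift_tlift _ _ tB) (tlift_tlift _ _ FB).
rewrite sw_exchange; apply: eq_tlift => c d.
rewrite (tlift_pure _ _ tB) (tlift_pure _ _ FB) mul1r /tmul2 /tmul.
rewrite tlift_tlift; last by case: FT.
apply: eq_tlift => a b; rewrite tlift_pure; last first.
  by apply: balanced_no_rel; exact: bil_mul2.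
by rewrite tlift_pure ?mulr1 //; case: FT.
Qed.

Lemma star_balanced f : balanced no_rel f ->
  balanced no_rel (fun a b => f (star a) (star b)).
Proof.
move=> fB; split=> // [v v' w|v w w'|c v w].
- by rewrite starD (balancedDl fB).
- by rewrite starD (balancedDr fB).
- by rewrite !starZ (balancedZ fB).
Qed.

(* Obtained by applying [star] to [comul1]; this makes the trilinear map       *)
(* antilinear, which is why these rules are stated for balanced maps.          *)
Lemma sw1_mid_balanced' F : balanced3 F ->
  \sw_(a, b <- 1) \sw_(c, d <- 1) F a (c * b) d =
  \sw_(a, b <- 1) \sw_(c, d <- a) F c d b.
Proof.
move=> FT; pose F' a b c := F (star a) (star b) (star c).
have FT' : balanced3 F'.
  by have [F1 F2] := FT; split=> c;
    [exact: (star_balanced (F1 (star c))) | exact: (star_balanced (F2 (star c)))].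
have swb f : balanced no_rel f -> sw H f 1 = \sw_(a, b <- 1) f (star a) (star b).
  by move=> fB; rewrite -{1}star1 sw_star_balanced.
transitivity (\sw_(a, b <- 1) \sw_(c, d <- 1) F' a (b * c) d).
  rewrite swb; last first.
    have [F1 F2] := FT; split=> // [a a' b|a b b'|k a b].
    - rewrite !swE -big_split; apply: eq_bigr => z _.
      by rewrite (balancedDl (F1 _)).
    - rewrite !swE -big_split; apply: eq_bigr => z _.
      by rewrite mulrDr (balancedDr (F1 _)).
    - apply: eq_sw => c d.
      by rewrite (balancedZ (F1 _)) -sa_scalerAr.
  apply: eq_sw => a b; rewrite swb; last first.
    have [F1 F2] := FT; split=> // [v v' w|v w w'|k v w].
    - by rewrite mulrDl (balancedDl (F2 _)).
    - by rewrite (balancedDr (F2 _)).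
    - by rewrite -sa_scalerAl (balancedZ (F2 _)).
  by apply: eq_sw => c d; rewrite /F' starM.
rewrite sw1_mid_balanced // /F' [RHS]swb; last first.
  have [F1 F2] := FT; split=> // [a a' b|a b b'|k a b].
  - by rewrite /sw linearD tliftD.
  - rewrite !swE -big_split; apply: eq_bigr => z _.
    by rewrite (balancedDr (F2 _)).
  - rewrite /sw linearZ tliftZ //.
    apply: eq_tlift => c d.
    by rewrite (balancedZ (F1 _)) (balancedZ (F2 _)).
by apply: eq_sw => a b; rewrite sw_star_balanced //; case: FT.
Qed.

End BalancedRules.

Section Rules.
Context {C : numClosedFieldType} {A : finCstarAlg C} (H : weakHopf A).
Local Notation "\sw_ ( a , b <- x ) F" := (sw H (fun a b => F) x).
Local Notation S := (antipode H).
Local Notation e := (counit H).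
Context {U : lmodType C}.
Implicit Types (f : A -> A -> U) (F : A -> A -> A -> U) (x y z : A).

Lemma tri_balanced3 F : tri F -> balanced3 F.
Proof. by move=> [F1 F2 F3]; split=> c; apply: balanced_no_rel; split. Qed.

Lemma sw_mul f x y : bil f ->
  sw H f (x * y) = \sw_(a, b <- x) \sw_(c, d <- y) f (a * c) (b * d).
Proof. by move=> /balanced_no_rel; exact: sw_mul_balanced. Qed.

Lemma sw_assoc F x : tri F ->
  \sw_(a, b <- x) \sw_(c, d <- a) F c d b =
  \sw_(a, b <- x) \sw_(c, d <- b) F a c d.
Proof. by move=> /tri_balanced3; exact: sw_assoc_balanced. Qed.

Lemma sw1_mid F : tri F ->
  \sw_(a, b <- 1) \sw_(c, d <- 1) F a (b * c) d =
  \sw_(a, b <- 1) \sw_(c, d <- a) F c d b.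
Proof. by move=> /tri_balanced3; exact: sw1_mid_balanced. Qed.

Lemma sw1_mid' F : tri F ->
  \sw_(a, b <- 1) \sw_(c, d <- 1) F a (c * b) d =
  \sw_(a, b <- 1) \sw_(c, d <- a) F c d b.
Proof. by move=> /tri_balanced3; exact: sw1_mid_balanced'. Qed.

Lemma sw_star f x : bil f ->
  sw H f (star x) = \sw_(a, b <- x) f (star a) (star b).
Proof. by move=> /balanced_no_rel; exact: sw_star_balanced. Qed.

Lemma sw_counitl (g : A -> U) x : lin g -> \sw_(a, b <- x) (e a *: g b) = g x.
Proof.
move=> gL; rewrite -[in RHS](counitl H x) lin_swr //.
by apply: eq_sw => a b; rewrite (linZ _ _ gL).
Qed.

Lemma sw_counitr (g : A -> U) x : lin g -> \sw_(a, b <- x) (e b *: g a) = g x.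
Proof.
move=> gL; rewrite -[in RHS](counitr H x) lin_swr //.
by apply: eq_sw => a b; rewrite (linZ _ _ gL).
Qed.

Lemma counitMZ x y z (u : U) :
  e (x * y * z) *: u = \sw_(a, b <- y) (e (x * a) *: (e (b * z) *: u)).
Proof.
rewrite counitM tliftE scaler_suml swE; apply: eq_bigr => w _.
by rewrite scalerA.
Qed.
End Rules.

Section CounitStar.
Context {C : numClosedFieldType} {A : finCstarAlg C} (H : weakHopf A).
Local Notation "\sw_ ( a , b <- x ) F" := (sw H (fun a b => F) x).
Local Notation e := (counit H).

(** Uniqueness of the counit: x |-> conj(e(star x)) is a left counit by [E]. Evaluating Delta(x)
    with it on the first leg and with [e] on the second yields either functional. *)
Lemma counit_star x : e (star x) = (e x)^*.
Proof.
have E (y : A) : \sw_(a, b <- y) ((e (star a))^* *: b) = y.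
  rewrite -[RHS]starK -[star y in RHS](sw_counitl H _ lin_id) sw_star; last by lin.
  rewrite (@sw_morph _ _ H _ _ (star)) ?star0 //; last exact: starD.
  by apply: eq_sw => a b; rewrite starZ starK.
suff <- : (e (star x))^* = e x by rewrite conjCK.
rewrite -{1}[x](sw_counitr H _ lin_id) -[in RHS](E x).
rewrite (@sw_morph _ _ H _ _ (fun y => (e (star y))^*)); first last.
- by move=> u v; rewrite starD linearD rmorphD.
- by rewrite star0 linear0 rmorph0.
rewrite (@sw_morph _ _ H _ _ (e)) ?linear0 //; last exact: linearD.
by apply: eq_sw => a b; rewrite starZ !linearZ /= rmorphM /= conjCK mulrC.
Qed.

(** Weak multiplicativity of the counit with the legs of y in the other order, obtained by applying
    the star to the axiom. *)
Lemma counitM' x y z : 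
  e (x * y * z) = \sw_(a, b <- y) (e (x * b) * e (a * z)).
Proof.
rewrite -[x * y * z]starK counit_star !starM mulrA counitM.
rewrite -/(sw H _ _) sw_star_balanced; last first.
  split=> // [a b c|a b c|k a b].
  - by rewrite mulrDr linearD mulrDl.
  - by rewrite mulrDl linearD mulrDr.
  - by rewrite -sa_scalerAr -sa_scalerAl !linearZ /= mulrCA mulrA.
rewrite (@sw_morph _ _ H _ _ (Num.conj)) ?rmorph0 //; last exact: rmorphD.
apply: eq_sw => a b.
by rewrite rmorphM /= -!counit_star !starM !starK mulrC.
Qed.

End CounitStar.

(** * Counital maps and the antipode *)

Section Counital.
Context {C : numClosedFieldType} {A : finCstarAlg C} (H : weakHopf A).
Local Notation "\sw_ ( a , b <- x ) F" := (sw H (fun a b => F) x).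
Local Notation S := (antipode H).
Local Notation e := (counit H).
Implicit Types (x y l r : A).

Definition scalar_of (f : A -> C) (fP : scalar f) : {scalar A} :=
  HB.pack f (GRing.isLinear.Build C A C *%R f fP).

Lemma findim_basis : exists n (phi : 'I_n -> {scalar A}) (b : 'I_n -> A),
  forall x, x = \sum_i phi i x *: b i.
Proof.
have [v2r vL [r2v v2rK r2vK]] := ca_findim A.
exists (ca_dim A).
have phiP i : scalar (fun x : A => v2r x 0 i).
  by move=> c x y; rewrite vL !mxE.
exists (fun i => scalar_of (phiP i)), (fun i => r2v (delta_mx 0 i)) => x.
apply: (can_inj v2rK); rewrite [LHS]row_sum_delta.
have v2rD : {morph v2r : u v / u + v} by move=> u v; rewrite -[u]scale1r vL !scale1r.
have v2r0 : v2r 0 = 0 by apply: (addIr (v2r 0)); rewrite -v2rD !add0r.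
rewrite (big_morph v2r v2rD v2r0); apply: eq_bigr => i _.
by rewrite -[_ *: r2v _]addr0 vL v2r0 addr0 r2vK.
Qed.

(* The projections of A onto A_L and A_R, usually written Pi^L and Pi^R.       *)
Definition eL x : A := \sw_(a, b <- 1) (e (a * x) *: b).
Definition eR x : A := \sw_(a, b <- 1) (e (x * b) *: a).

Lemma sw_mulS x : \sw_(a, b <- x) (a * S b) = eL x.
Proof. exact: antipoder. Qed.

Lemma sw_Smul x : \sw_(a, b <- x) (S a * b) = eR x.
Proof. exact: antipodel. Qed.

Lemma AL_eL x : AL H (eL x).
Proof.
have fP : scalar (fun a : A => e (a * x)).
  by move=> c u v; rewrite mulrDl -sa_scalerAl linearP.
by exists (scalar_of fP).
Qed.

Lemma AR_eR x : AR H (eR x).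
Proof.
have fP : scalar (fun a : A => e (x * a)).
  by move=> c u v; rewrite mulrDr -sa_scalerAr linearP.
by exists (scalar_of fP).
Qed.

Lemma lin_eL {U : lmodType C} (f : U -> A) : lin f -> lin (fun u => eL (f u)).
Proof. by move=> fL; rewrite /eL; lin. Qed.

Lemma lin_eR {U : lmodType C} (f : U -> A) : lin f -> lin (fun u => eR (f u)).
Proof. by move=> fL; rewrite /eR; lin. Qed.

Section Rules.
Context {U : lmodType C}.
Implicit Types (f g : A -> A -> U).

Lemma sw_1l f x : bil f ->
  \sw_(a, b <- 1) \sw_(c, d <- x) f (a * c) (b * d) = sw H f x.
Proof. by move=> fB; rewrite -sw_mul // mul1r. Qed.

Lemma sw_1r f x : bil f ->
  \sw_(a, b <- x) \sw_(c, d <- 1) f (a * c) (b * d) = sw H f x.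
Proof. by move=> fB; rewrite -sw_mul // mulr1. Qed.

(** The second leg of Delta(1) lies in A_L: when the first leg is expanded in coordinates, the
    coefficients are (phi_i ⊗ id)(Delta(1)), elements of A_L by definition. *)
Lemma sw1_AL f g : bil f -> bil g -> (forall a l, AL H l -> f a l = g a l) ->
  sw H f 1 = sw H g 1.
Proof.
move=> fB gB fg; have [n [phi [b bE]]] := findim_basis.
have E h : bil h -> sw H h 1 = \sum_i h (b i) (\sw_(c, d <- 1) (phi i c *: d)).
  move=> hB; under eq_bigr => i _ do rewrite (lin_swr H _ _ (hB.2 (b i))) swE.
  rewrite exchange_big swE; apply: eq_bigr => z _ /=.
  rewrite {1}[z.1]bE (lin_sum _ _ _ (hB.1 z.2)); apply: eq_bigr => i _.
  by rewrite (linZ _ _ (hB.1 z.2)) (linZ _ _ (hB.2 (b i))).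
by rewrite !E //; apply: eq_bigr => i _; apply: fg; exists (phi i).
Qed.

Let sw_ALE f (phi : {scalar A}) : bil f ->
  sw H f (\sw_(a, b <- 1) (phi a *: b)) =
  \sw_(a, b <- 1) \sw_(c, d <- a) (phi c *: f d b).
Proof.
move=> fB; rewrite (@lin_swr _ _ H _ _ (sw H f)); last by lin.
rewrite sw_assoc; last by lin.
apply: eq_sw => a b; rewrite -(@lin_swr _ _ H _ _ (fun u => phi a *: u)); last by lin.
by rewrite (@linZ _ _ _ (sw H f)); last by lin.
Qed.

Let sw_ARE f (phi : {scalar A}) : bil f ->
  sw H f (\sw_(a, b <- 1) (phi b *: a)) =
  \sw_(a, b <- 1) \sw_(c, d <- a) (phi b *: f c d).
Proof.
move=> fB; rewrite (@lin_swr _ _ H _ _ (sw H f)); last by lin.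
apply: eq_sw => a b; rewrite -(@lin_swr _ _ H _ _ (fun u => phi b *: u)); last by lin.
by rewrite (@linZ _ _ _ (sw H f)); last by lin.
Qed.

(** For l = (phi ⊗ id)(Delta(1)), coassociativity gives Delta(l) = phi(1_(1)) 1_(2) ⊗ 1_(3), which
    splits as phi(1_(1)) 1_(2) 1_(1') ⊗ 1_(2'). The starred axiom reverses the middle product,
    whence [sw_AL']; the rules for A_R are mirror images. *)
Lemma sw_AL f l : AL H l -> bil f -> sw H f l = \sw_(a, b <- 1) f (l * a) b.
Proof.
move=> [phi ->] fB; rewrite sw_ALE // -sw1_mid; last by lin.
rewrite sw_exchange; apply: eq_sw => c d.
rewrite (@lin_swr _ _ H _ _ (fun u : A => f (u * c) d)); last by lin.
by apply: eq_sw => a b; rewrite -sa_scalerAl (linZ _ _ (fB.1 d)).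
Qed.

Lemma sw_AL' f l : AL H l -> bil f -> sw H f l = \sw_(a, b <- 1) f (a * l) b.
Proof.
move=> [phi ->] fB; rewrite sw_ALE // -sw1_mid'; last by lin.
rewrite sw_exchange; apply: eq_sw => c d.
rewrite (@lin_swr _ _ H _ _ (fun u : A => f (c * u) d)); last by lin.
by apply: eq_sw => a b; rewrite -sa_scalerAr (linZ _ _ (fB.1 d)).
Qed.

Lemma sw_AR f r : AR H r -> bil f -> sw H f r = \sw_(a, b <- 1) f a (r * b).
Proof.
move=> [phi ->] fB; rewrite sw_ARE //.
rewrite -(@sw1_mid' _ _ H _ (fun c d b => phi b *: f c d)); last by lin.
apply: eq_sw => a b.
rewrite (@lin_swr _ _ H _ _ (fun u : A => f a (u * b))); last by lin.
by apply: eq_sw => c d; rewrite -sa_scalerAl (linZ _ _ (fB.2 a)).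
Qed.

Lemma sw_AR' f r : AR H r -> bil f -> sw H f r = \sw_(a, b <- 1) f a (b * r).
Proof.
move=> [phi ->] fB; rewrite sw_ARE //.
rewrite -(@sw1_mid _ _ H _ (fun c d b => phi b *: f c d)); last by lin.
apply: eq_sw => a b.
rewrite (@lin_swr _ _ H _ _ (fun u : A => f a (b * u))); last by lin.
by apply: eq_sw => c d; rewrite -sa_scalerAr (linZ _ _ (fB.2 a)).
Qed.

Lemma sw_ALl f l x : AL H l -> bil f ->
  sw H f (l * x) = \sw_(a, b <- x) f (l * a) b.
Proof.
move=> lL fB; rewrite sw_mul // (sw_AL lL); last by lin.
rewrite -[in RHS](@sw_1l (fun a b => f (l * a) b)); last by lin.
by do 2![apply: eq_sw => ? ?]; rewrite mulrA.
Qed.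

Lemma sw_ALr f l x : AL H l -> bil f ->
  sw H f (x * l) = \sw_(a, b <- x) f (a * l) b.
Proof.
move=> lL fB; rewrite sw_mul //.
rewrite -[in RHS](@sw_1r (fun a b => f (a * l) b)); last by lin.
apply: eq_sw => a b; rewrite (sw_AL' lL); last by lin.
by apply: eq_sw => ? ?; rewrite mulrA.
Qed.

Lemma sw_ARl f r x : AR H r -> bil f ->
  sw H f (r * x) = \sw_(a, b <- x) f a (r * b).
Proof.
move=> lR fB; rewrite sw_mul // (sw_AR lR); last by lin.
rewrite -[in RHS](@sw_1l (fun a b => f a (r * b))); last by lin.
by do 2![apply: eq_sw => ? ?]; rewrite mulrA.
Qed.

Lemma sw_ARr f r x : AR H r -> bil f ->
  sw H f (x * r) = \sw_(a, b <- x) f a (b * r).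
Proof.
move=> lR fB; rewrite sw_mul //.
rewrite -[in RHS](@sw_1r (fun a b => f a (b * r))); last by lin.
apply: eq_sw => a b; rewrite (sw_AR' lR); last by lin.
by apply: eq_sw => ? ?; rewrite mulrA.
Qed.

End Rules.
End Counital.

(** * Calculus of the counital projections *)

Ltac lin_hook ::= first [apply: lin_eL | apply: lin_eR].

Section Antipode.
Context {C : numClosedFieldType} {A : finCstarAlg C} (H : weakHopf A).
Local Notation "\sw_ ( a , b <- x ) F" := (sw H (fun a b => F) x).
Local Notation S := (antipode H).
Local Notation e := (counit H).
Local Notation eL := (eL H).
Local Notation eR := (eR H).
Implicit Types (x y l r : A).

(** Both products arise by applying functionals to the outer legs of 1_(1) ⊗ 1_(2) ⊗ 1_(3), whose
    middle leg is a product of legs of two copies of Delta(1), in either order. *)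
Lemma AL_AR_comm l r : AL H l -> AR H r -> l * r = r * l.
Proof.
move=> [phi ->] [psi ->].
pose F (a b c : A) : A := phi a *: (psi c *: b).
have FT : tri F by rewrite /F; lin.
transitivity (\sw_(a, b <- 1) \sw_(c, d <- 1) F a (b * c) d).
  rewrite (@lin_swr _ _ H _ _ (fun u : A => u * _)); last by lin.
  apply: eq_sw => a b; rewrite (@lin_swr _ _ H _ _ (fun u : A => _ * u)); last by lin.
  by apply: eq_sw => c d; rewrite /F -sa_scalerAl -sa_scalerAr.
rewrite sw1_mid // -sw1_mid' //.
rewrite (@lin_swr _ _ H _ _ (fun u : A => _ * u)); last by lin.
apply: eq_sw => a b; rewrite (@lin_swr _ _ H _ _ (fun u : A => u * _)); last by lin.
by apply: eq_sw => c d; rewrite /F -sa_scalerAl -sa_scalerAr scalerA mulrC -scalerA.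
Qed.

(** The left side is e(x 1_(2)) e(1_(1) y), so this is [counitM'] with middle factor 1. *)
Lemma counit_eL x y : e (x * eL y) = e (x * y).
Proof.
rewrite (@sw_morph _ _ H _ _ (fun u : A => e (x * u))); first last.
- by move=> u v; rewrite mulrDr linearD.
- by rewrite mulr0 linear0.
rewrite -[x in RHS]mulr1 counitM'; apply: eq_sw => a b.
by rewrite -sa_scalerAr linearZ mulrC.
Qed.

Lemma counit_eR x y : e (eR x * y) = e (x * y).
Proof.
rewrite (@sw_morph _ _ H _ _ (fun u : A => e (u * y))); first last.
- by move=> u v; rewrite mulrDl linearD.
- by rewrite mul0r linear0.
rewrite -[x in RHS]mulr1 counitM'; apply: eq_sw => a b.
by rewrite -sa_scalerAl linearZ.
Qed.

Lemma eL_mul_eL x y : eL (x * eL y) = eL (x * y).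
Proof. by apply: eq_sw => a b; rewrite !mulrA counit_eL. Qed.

Lemma eR_eR_mul x y : eR (eR x * y) = eR (x * y).
Proof. by apply: eq_sw => a b; rewrite -!mulrA counit_eR. Qed.

Lemma eL_eL x : eL (eL x) = eL x.
Proof. by have := eL_mul_eL 1 x; rewrite !mul1r. Qed.

Lemma eL1 : eL 1 = 1.
Proof.
rewrite -[RHS](sw_counitl H 1 (@lin_id _ _)).
by apply: eq_sw => a b; rewrite mulr1.
Qed.

Lemma eR1 : eR 1 = 1.
Proof.
rewrite -[RHS](sw_counitr H 1 (@lin_id _ _)).
by apply: eq_sw => a b; rewrite mul1r.
Qed.

Lemma AL1 : AL H 1.
Proof. by rewrite -eL1; exact: AL_eL. Qed.

Lemma eL_mull l x : AL H l -> eL (l * x) = l * eL x.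
Proof.
move=> lL; rewrite -!sw_mulS (sw_ALl _ lL); last by lin.
rewrite (@lin_swr _ _ H _ _ (fun u : A => l * u)); last by lin.
by apply: eq_sw => a b; rewrite mulrA.
Qed.

Lemma eR_mulr r x : AR H r -> eR (x * r) = eR x * r.
Proof.
move=> rR; rewrite -!sw_Smul (sw_ARr _ rR); last by lin.
rewrite (@lin_swr _ _ H _ _ (fun u : A => u * r)); last by lin.
by apply: eq_sw => a b; rewrite mulrA.
Qed.

Lemma eL_id l : AL H l -> eL l = l.
Proof. by move=> lL; rewrite -{1}[l]mulr1 eL_mull // eL1 mulr1. Qed.

Lemma eR_id r : AR H r -> eR r = r.
Proof. by move=> rR; rewrite -{1}[r]mul1r eR_mulr // eR1 mul1r. Qed.

(** Apply the counit to the first leg of Delta(1) Delta(x) = Delta(x). *)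
Lemma sw_eLl x : \sw_(a, b <- x) (eL a * b) = x.
Proof.
rewrite -[RHS](sw_counitl H x (@lin_id _ _)) -[RHS]sw_1l; last by lin.
rewrite [RHS]sw_exchange; apply: eq_sw => c d.
rewrite (@lin_swr _ _ H _ _ (fun u : A => u * d)); last by lin.
by apply: eq_sw => a b; rewrite sa_scalerAl.
Qed.

Lemma sw_eRr x : \sw_(a, b <- x) (a * eR b) = x.
Proof.
rewrite -[RHS](sw_counitr H x (@lin_id _ _)) -[RHS]sw_1r; last by lin.
apply: eq_sw => c d.
rewrite (@lin_swr _ _ H _ _ (fun u : A => c * u)); last by lin.
by apply: eq_sw => a b; rewrite sa_scalerAr.
Qed.

(** Recover 1_(1) x from its coproduct by the counit on the second leg. The threefold coproduct of 1
    that appears splits in the reversed order, giving 1_(1) x_(1) ⊗ e(1_(1') 1_(2) x_(2)) 1_(2'),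
    and Delta(1) Delta(x) = Delta(x) absorbs the unprimed copy. *)
Lemma sw_eL {U : lmodType C} (f : A -> A -> U) x : bil f ->
  \sw_(a, b <- x) f a (eL b) = \sw_(a, b <- 1) f (a * x) b.
Proof.
move=> fB.
pose F (a b c : A) : U := \sw_(u, v <- x) (e (b * v) *: f (a * u) c).
have FT : tri F by rewrite /F; lin.
transitivity (\sw_(a, b <- 1) \sw_(c, d <- 1) F a (c * b) d); last first.
  rewrite sw1_mid' //; apply: eq_sw => a b; rewrite /F.
  rewrite -[RHS](@sw_counitr _ _ H _ (fun y => f y b)); last by lin.
  by rewrite sw_mul //; lin.
transitivity (\sw_(u, v <- x) \sw_(c, d <- 1) (e (c * v) *: f u d)).
  apply: eq_sw => a b; rewrite (@lin_swr _ _ H _ _ (f a)); last by lin.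
  by apply: eq_sw => c d; rewrite (linZ _ _ (fB.2 a)).
rewrite -[LHS]sw_1l; last by lin.
apply: eq_sw => a b; rewrite /F [RHS]sw_exchange; apply: eq_sw => c d.
by apply: eq_sw => u v; rewrite mulrA.
Qed.

Lemma sw_S_eL x : \sw_(a, b <- x) (S a * eL b) = S x.
Proof.
rewrite -[RHS]antipode3.
transitivity (\sw_(t, c <- x) \sw_(a, b <- t) (S a * b * S c)).
  rewrite sw_assoc; last by lin.
  apply: eq_sw => a b; rewrite -sw_mulS.
  rewrite (@lin_swr _ _ H _ _ (fun u : A => _ * u)); last by lin.
  by apply: eq_sw => ? ?; rewrite mulrA.
rewrite -(@tlift_comul _ _ H _ (fun a b c => S a * b * S c)) //.
by apply: tri_balanced3; lin.
Qed.

Lemma sw_eR_S x : \sw_(a, b <- x) (eR a * S b) = S x.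
Proof.
rewrite -[RHS]sw_S_eL.
transitivity (\sw_(t, c <- x) \sw_(a, b <- t) (S a * b * S c)).
  apply: eq_sw => a b; rewrite -sw_Smul.
  by rewrite (@lin_swr _ _ H _ _ (fun u : A => u * _)); last by lin.
rewrite sw_assoc; last by lin.
apply: eq_sw => a b; rewrite -sw_mulS.
rewrite (@lin_swr _ _ H _ _ (fun u : A => _ * u)); last by lin.
by apply: eq_sw => ? ?; rewrite mulrA.
Qed.

End Antipode.

(** * Antimultiplicativity and inverse of the antipode *)

Section AntipodeMul.
Context {C : numClosedFieldType} {A : finCstarAlg C} (H : weakHopf A).
Local Notation "\sw_ ( a , b <- x ) F" := (sw H (fun a b => F) x).
Local Notation S := (antipode H).
Local Notation e := (counit H).
Local Notation eL := (eL H).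
Local Notation eR := (eR H).
Implicit Types (x y l r : A).

(** Coassociativity in two variables at once: [a], [b], [u] are the three legs of x, and [c], [d],
    [v] those of y. *)
Lemma sw_assoc2 {U : lmodType C} (G : A -> A -> A -> A -> A -> A -> U) x y :
  (forall c d v, tri (fun a b u => G a b u c d v)) ->
  (forall a b u, tri (G a b u)) ->
  \sw_(p, u <- x) \sw_(q, v <- y) \sw_(a, b <- p) \sw_(c, d <- q) G a b u c d v =
  \sw_(a, p <- x) \sw_(c, q <- y) \sw_(b, u <- p) \sw_(d, v <- q) G a b u c d v.
Proof.
move=> Gl Gr.
transitivity (\sw_(p, u <- x) \sw_(a, b <- p)
    \sw_(q, v <- y) \sw_(c, d <- q) G a b u c d v).
  by apply: eq_sw => p u; rewrite sw_exchange.
rewrite sw_assoc; last first.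
  split=> a b; apply: lin_sw => q v; apply: lin_sw => c d;
    by have [G1 G2 G3] := Gl c d v.
apply: eq_sw => a p; rewrite [RHS]sw_exchange; apply: eq_sw => b u.
exact: (sw_assoc H y (Gr a b u)).
Qed.

(** The inner factor S(x_(1)) x_(2) is eR(x); lying in A_R, it can be pulled into the second leg of
    Delta(y). *)
Lemma sw_SS_mul x y :
  \sw_(a, b <- x) \sw_(c, d <- y) (S c * S a * (b * d)) = eR (x * y).
Proof.
rewrite -eR_eR_mul -[RHS]sw_Smul (sw_ARl _ (AR_eR H x)); last by lin.
rewrite sw_exchange; apply: eq_sw => c d; rewrite -sw_Smul.
rewrite (@lin_swr _ _ H _ _ (fun u : A => S c * (u * d))); last by lin.
by apply: eq_sw => a b; rewrite !mulrA.
Qed.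

Lemma sw_mul_SS x y :
  \sw_(a, b <- x) \sw_(c, d <- y) (a * c * (S d * S b)) = eL (x * y).
Proof.
rewrite -eL_mul_eL -[RHS]sw_mulS (sw_ALr _ (AL_eL H y)); last by lin.
apply: eq_sw => a b; rewrite -sw_mulS.
rewrite (@lin_swr _ _ H _ _ (fun u : A => a * u * S b)); last by lin.
by apply: eq_sw => c d; rewrite !mulrA.
Qed.

(* With S, the product m and nu(x, y) = S(y) S(x) in the convolution algebra   *)
(* of maps A x A -> A, both sides equal (S m) * m * (S m) = nu * m * nu.       *)
Lemma antipodeM x y : S (x * y) = S y * S x.
Proof.
transitivity (\sw_(a, p <- x) \sw_(c, q <- y) (S c * S a * eL (p * q))).
  rewrite -(sw_eR_S H (x * y)) sw_mul; last by lin.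
  transitivity (\sw_(p, u <- x) \sw_(q, v <- y) \sw_(a, b <- p) \sw_(c, d <- q)
                  (S c * S a * (b * d * S (u * v)))).
    apply: eq_sw => p u; apply: eq_sw => q v.
    rewrite -sw_SS_mul (@lin_swr _ _ H _ _ (fun t : A => t * _)); last by lin.
    apply: eq_sw => a b.
    rewrite (@lin_swr _ _ H _ _ (fun t : A => t * _)); last by lin.
    by apply: eq_sw => c d; rewrite !mulrA.
  rewrite (@sw_assoc2 _ (fun a b u c d v => S c * S a * (b * d * S (u * v))));
    try by intros; lin.
  apply: eq_sw => a p; apply: eq_sw => c q.
  rewrite -(sw_mulS H (p * q)) sw_mul; last by lin.
  rewrite (@lin_swr _ _ H _ _ (fun t : A => _ * t)); last by lin.
  apply: eq_sw => b u.
  by rewrite (@lin_swr _ _ H _ _ (fun t : A => _ * t)); last by lin.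
transitivity (\sw_(p, u <- x) \sw_(c, q <- y) (S c * eL q * (eR p * S u))).
  transitivity (\sw_(a, p <- x) \sw_(b, u <- p) \sw_(c, q <- y)
                  (S c * S a * b * eL q * S u)).
    apply: eq_sw => a p; rewrite [RHS]sw_exchange; apply: eq_sw => c q.
    rewrite -sw_mul_SS (@lin_swr _ _ H _ _ (fun t : A => _ * t)); last by lin.
    apply: eq_sw => b u; rewrite -sw_mulS.
    rewrite (@lin_swr _ _ H _ _ (fun t : A => _ * t)); last by lin.
    rewrite (@lin_swr _ _ H _ _ (fun t : A => _ * t * S u)); last by lin.
    by apply: eq_sw => d v; rewrite !mulrA.
  rewrite -(@sw_assoc _ _ H _
    (fun a b u => \sw_(c, q <- y) (S c * S a * b * eL q * S u))); last by lin.
  apply: eq_sw => p u; rewrite [LHS]sw_exchange; apply: eq_sw => c q.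
  rewrite mulrA -(mulrA (S c)) (AL_AR_comm (AL_eL H q) (AR_eR H p)) -sw_Smul.
  rewrite (@lin_swr _ _ H _ _ (fun t : A => S c * (t * eL q) * S u)); last by lin.
  by apply: eq_sw => a b; rewrite !mulrA.
rewrite -[in RHS](sw_S_eL H y) -[in RHS](sw_eR_S H x).
rewrite (@lin_swr _ _ H _ _ (fun t : A => t * _)); last by lin.
rewrite sw_exchange; apply: eq_sw => c q.
by rewrite (@lin_swr _ _ H _ _ (fun t : A => S c * eL q * t)); last by lin.
Qed.

(** Since Delta(r) = 1_(1) ⊗ r 1_(2), one has eL(r) = 1_(1) S(1_(2)) S(r) = eL(1) S(r). *)
Lemma antipode_AR r : AR H r -> S r = eL r.
Proof.
move=> rR; rewrite -sw_mulS (sw_AR rR); last by lin.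
transitivity (\sw_(a, b <- 1) (a * S b * S r)).
  rewrite -(@lin_swr _ _ H _ _ (fun t : A => t * S r)); last by lin.
  by rewrite sw_mulS eL1 mul1r.
by apply: eq_sw => a b; rewrite antipodeM mulrA.
Qed.

Lemma antipode_AL l : AL H l -> S l = eR l.
Proof.
move=> lL; rewrite -sw_Smul (sw_AL' lL); last by lin.
transitivity (\sw_(a, b <- 1) (S l * (S a * b))).
  rewrite -(@lin_swr _ _ H _ _ (fun t : A => S l * t)); last by lin.
  by rewrite sw_Smul eR1 mulr1.
by apply: eq_sw => a b; rewrite antipodeM mulrA.
Qed.

Lemma AL_antipode r : AR H r -> AL H (S r).
Proof. by move=> /antipode_AR ->; exact: AL_eL. Qed.

Lemma AR_antipode l : AL H l -> AR H (S l).
Proof. by move=> /antipode_AL ->; exact: AR_eR. Qed.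

(* The counital projections of the co-opposite structure, whose antipode is    *)
(* x |-> S(x^* )^*.                                                            *)
Definition coeL x : A := \sw_(a, b <- 1) (e (x * a) *: b).
Definition coeR x : A := \sw_(a, b <- 1) (e (b * x) *: a).

Lemma AL_coeL x : AL H (coeL x).
Proof.
have fP : scalar (fun a : A => e (x * a)).
  by move=> c u v; rewrite mulrDr -sa_scalerAr linearP.
by exists (scalar_of fP).
Qed.

Lemma AR_coeR x : AR H (coeR x).
Proof.
have fP : scalar (fun a : A => e (a * x)).
  by move=> c u v; rewrite mulrDl -sa_scalerAl linearP.
by exists (scalar_of fP).
Qed.

Lemma star_sw (f g : A -> A -> A) x : bil g ->
  (forall a b, star (f a b) = g (star a) (star b)) ->
  star (sw H f x) = sw H g (star x).
Proof.
move=> gB fg; rewrite (@sw_morph _ _ H _ _ star) ?star0 //; last exact: starD.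
by rewrite sw_star //; apply: eq_sw.
Qed.

Lemma star_eL x : star (eL x) = coeL (star x).
Proof.
rewrite (@star_sw _ (fun a b => e (star x * a) *: b)) ?star1 //; first by lin.
by move=> a b; rewrite starZ -counit_star starM.
Qed.

Lemma star_eR x : star (eR x) = coeR (star x).
Proof.
rewrite (@star_sw _ (fun a b => e (b * star x) *: a)) ?star1 //; first by lin.
by move=> a b; rewrite starZ -counit_star starM.
Qed.

Lemma AL_star l : AL H l -> AL H (star l).
Proof. by move=> /eL_id <-; rewrite star_eL; exact: AL_coeL. Qed.

Lemma AR_star r : AR H r -> AR H (star r).
Proof. by move=> /eR_id <-; rewrite star_eR; exact: AR_coeR. Qed.

(** By [antipode_AR] the left side is eL(coeR(x)); weak multiplicativity of the counit with middle
    factor 1 contracts it to eL(x). *)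
Lemma antipode_coeR x : S (coeR x) = eL x.
Proof.
rewrite (antipode_AR (AR_coeR x)); apply: eq_sw => c d.
rewrite -[c in RHS]mulr1 counitMZ.
rewrite (@lin_swr _ _ H _ _ (fun t : A => e (c * t) *: d)); last by lin.
by apply: eq_sw => a b; rewrite -sa_scalerAr linearZ /= scalerA mulrC -scalerA.
Qed.

Lemma antipode_coeL x : S (coeL x) = eR x.
Proof.
rewrite (antipode_AL (AL_coeL x)); apply: eq_sw => c d.
rewrite -[x in RHS]mulr1 counitMZ.
rewrite (@lin_swr _ _ H _ _ (fun t : A => e (t * d) *: c)); last by lin.
by apply: eq_sw => a b; rewrite -sa_scalerAl linearZ /= scalerA.
Qed.

Lemma lin_costar {U : lmodType C} (f : U -> A) :
  lin f -> lin (fun u => star (S (star (f u)))).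
Proof.
by move=> fL c x y; rewrite fL starD starZ linearP starD starZ conjCK.
Qed.

Local Notation S' x := (star (S (star x))).

Lemma sw_mul_costar x : \sw_(a, b <- x) (b * S' a) = coeR x.
Proof.
rewrite -[x in RHS]starK -star_eR -sw_Smul (@star_sw _ (fun a b => b * S' a)).
- by rewrite starK.
- by split=> [b|a]; [apply/lin_mull/lin_costar | lin].
- by move=> a b; rewrite starM !starK.
Qed.

Lemma sw_costar_mul x : \sw_(a, b <- x) (S' b * a) = coeL x.
Proof.
rewrite -[x in RHS]starK -star_eL -sw_mulS (@star_sw _ (fun a b => S' b * a)).
- by rewrite starK.
- by split=> [b|a]; [lin | apply/lin_mulr/lin_costar].
- by move=> a b; rewrite starM !starK.
Qed.

Lemma sw_costar_coeR x : \sw_(a, b <- x) (S' b * coeR a) = S' x.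
Proof.
rewrite -[in RHS](sw_eR_S H (star x)) (@star_sw _ (fun a b => S' b * coeR a)).
- by rewrite starK.
- split=> [b|a]; last exact/lin_mulr/lin_costar.
  by rewrite /coeR; lin.
- by move=> a b; rewrite starM star_eR !starK.
Qed.

(** Writing S' for the candidate inverse, S(S'(x)) = eL(x_(1)) S(S'(x_(2))) = x_(1) S(x_(2))
    S(S'(x_(3))) = x_(1) S(S'(x_(3)) x_(2)) = x_(1) eR(x_(2)) = x. *)
Lemma antipode_costar x : S (S' x) = x.
Proof.
have LS : lin (fun u => S (S' u)) by exact/lin_antipode/lin_costar.
transitivity (\sw_(a, b <- x) (eL a * S (S' b))).
  rewrite -sw_costar_coeR (@lin_swr _ _ H _ _ S); last exact: lin_antipode.
  by apply: eq_sw => a b; rewrite antipodeM antipode_coeR.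
transitivity (\sw_(p, d <- x) \sw_(a, c <- p) (a * S c * S (S' d))).
  apply: eq_sw => p d; rewrite -sw_mulS.
  by rewrite (@lin_swr _ _ H _ _ (fun t : A => t * _)) //; lin.
rewrite sw_assoc; last first.
  by split=> a c; [lin | lin | exact: lin_mull].
rewrite -[RHS](sw_eRr H); apply: eq_sw => a b.
rewrite -antipode_coeL -sw_costar_mul (@lin_swr _ _ H _ _ S); last exact: lin_antipode.
rewrite (@lin_swr _ _ H _ _ (fun t : A => a * t)); last by lin.
by apply: eq_sw => c d; rewrite antipodeM mulrA.
Qed.

Lemma antipode_star_antipode x : S (star (S x)) = star x.
Proof. by rewrite -[in LHS](starK x) antipode_costar. Qed.

(** By [sw_eL] the left side is r_(1) ⊗ eL(r_(2)); moreover Delta(r) = 1_(1) ⊗ 1_(2) r and eL(1_(2)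
    r) = 1_(2) S(r). *)
Lemma sw1_mul_AR {U : lmodType C} (f : A -> A -> U) r : AR H r -> bil f ->
  \sw_(a, b <- 1) f (a * r) b = \sw_(a, b <- 1) f a (b * S r).
Proof.
move=> rR fB; rewrite -(sw_eL H r fB) (sw_AR' rR); last by lin.
apply: sw1_AL; [by lin | by lin |] => a l lL.
by rewrite eL_mull // antipode_AR.
Qed.

(** The separability property of S(1_(1)) ⊗ 1_(2). It is [sw1_mul_AR] for the element r = S'(l) of
    A_R, which satisfies S(r) = l. *)
Lemma sw1_antipode_AL {U : lmodType C} (f : A -> A -> U) l : AL H l -> bil f ->
  \sw_(a, b <- 1) f (l * S a) b = \sw_(a, b <- 1) f (S a) (b * l).
Proof.
move=> lL fB; have rR : AR H (S' l) by apply/AR_star/AR_antipode/AL_star.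
rewrite -(antipode_costar l) -(@sw1_mul_AR _ (fun a b => f (S a) b) _ rR).
  by apply: eq_sw => a b; rewrite antipodeM.
by lin.
Qed.
End AntipodeMul.

(** * The crossed product *)

Section Action.
Context {C : numClosedFieldType} {A : finCstarAlg C} {H : weakHopf A}.
Context {M : starAlg C} (act : moduleAlg H M).
Local Notation "\sw_ ( a , b <- x ) F" := (sw H (fun a b => F) x).
Local Notation S := (antipode H).
Local Notation e := (counit H).
Local Notation eL := (eL H).
Local Notation eR := (eR H).
Local Notation cp := (crossed_pure act).
Implicit Types (a b l r : A) (m n : M).

Lemma lin_actl {U : lmodType C} (f : U -> A) m :
  lin f -> lin (fun u => act (f u) m).
Proof. by move=> fL c x y; rewrite fL (action_linearl act m). Qed.

Lemma lin_actr {U : lmodType C} (f : U -> M) a :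
  lin f -> lin (fun u => act a (f u)).
Proof. by move=> fL c x y; rewrite fL (action_linearr act a). Qed.

Lemma lin_cpl {U : lmodType C} (f : U -> M) a :
  lin f -> lin (fun u => cp (f u) a).
Proof. exact: lin_bill bil_tpure. Qed.

Lemma lin_cpr {U : lmodType C} (f : U -> A) m :
  lin f -> lin (fun u => cp m (f u)).
Proof. exact: lin_bilr bil_tpure. Qed.

End Action.

Ltac lin_hook ::=
  first [ apply: lin_eL | apply: lin_eR | apply: lin_actl | apply: lin_actr
        | apply: lin_cpl | apply: lin_cpr | apply: lin_costar ].

(** * Product and star on the crossed product *)

Section Crossed.
Context {C : numClosedFieldType} {A : finCstarAlg C} {H : weakHopf A}.
Context {M : starAlg C} (act : moduleAlg H M).
Local Notation "\sw_ ( a , b <- x ) F" := (sw H (fun a b => F) x).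
Local Notation S := (antipode H).
Local Notation e := (counit H).
Local Notation eL := (eL H).
Local Notation eR := (eR H).
Local Notation cp := (crossed_pure act).
Local Notation X := (crossed act).
Implicit Types (a b l r : A) (m n : M) (t u : X).

Lemma act_mul a m n : act a (m * n) = \sw_(b, c <- a) (act b m * act c n).
Proof. exact: action_mul. Qed.

Lemma sw1_act m n : \sw_(b, c <- 1) (act b m * act c n) = m * n.
Proof. by rewrite -act_mul action1. Qed.

Lemma act_eL a : act (eL a) 1 = act a 1.
Proof. by rewrite (action_unit act a) -sw_mulS. Qed.

(** Delta(l) = 1_(1) l ⊗ 1_(2), and Delta(1) acts trivially on a product. For A_R the element sits
    in the second leg instead. *)
Lemma act_AL l m : AL H l -> act l m = act l 1 * m.
Proof.
move=> lL; rewrite -[m in LHS]mul1r act_mul (sw_AL' lL); last by lin.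
by rewrite -[RHS]sw1_act; apply: eq_sw => a b; rewrite actionM.
Qed.

Lemma act_AR r m : AR H r -> act r m = m * act r 1.
Proof.
move=> rR; rewrite -[m in LHS]mulr1 act_mul (sw_AR' rR); last by lin.
by rewrite -[RHS]sw1_act; apply: eq_sw => a b; rewrite actionM.
Qed.

(** The star axiom of the action gives star (S l) |> 1. As star (S l) lies in A_R, its image under
    eL is S(star (S l)) = star l, and only that image matters on 1. *)
Lemma star_act_AL l : AL H l -> star (act l 1) = act (star l) 1.
Proof.
move=> lL; rewrite action_star star1 /lowerstar -act_eL.
rewrite -antipode_AR; last exact/AR_star/AR_antipode.
by rewrite antipode_star_antipode.
Qed.

Lemma cp_AL m l a : AL H l -> cp m (l * a) = cp (m * act l 1) a.
Proof. by move=> lL; apply: tpureG; exists l. Qed.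

(** The factor a_(1) |> 1 = eL(a_(1)) |> 1 crosses the tensor sign, and eL(a_(1)) a_(2) = a. *)
Lemma sw_cp_act m a b :
  \sw_(p, q <- a) cp (m * act p 1) (q * b) = cp m (a * b).
Proof.
rewrite -[a in RHS](sw_eLl H) (@lin_swr _ _ H _ _ (fun x : A => cp m (x * b)));
  last by lin.
apply: eq_sw => p q.
by rewrite -act_eL -cp_AL -?mulrA //; exact: AL_eL.
Qed.

Definition crossed_mul_pure m a m' a' : X :=
  \sw_(p, q <- a) cp (m * act p m') (q * a').

(** By [sw_cp_act] and Delta(x l) = x_(1) l ⊗ x_(2), the element m (a_(1) |> m') # a_(2) l a' equals
    m (a_(1) |> m') (a_(2) l |> 1) # a_(3) a', which is what a acting on m' (l |> 1) produces. *)
Lemma crossed_mul_balancedr m a :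
  balanced (AL_rel act) (crossed_mul_pure m a).
Proof.
apply: balanced_bil; first by rewrite /crossed_mul_pure; lin.
move=> m' _ _ a' [l [lL -> ->]]; rewrite /crossed_mul_pure.
pose F p q r : X := cp (m * (act p m' * act (q * l) 1)) (r * a').
transitivity (\sw_(p, q <- a) \sw_(r, s <- q) F p r s).
  apply: eq_sw => p q; rewrite mulrA -sw_cp_act (sw_ALr _ lL); last by lin.
  by apply: eq_sw => r s; rewrite /F mulrA.
rewrite -sw_assoc; last by rewrite /F; lin.
apply: eq_sw => p q; rewrite act_mul.
rewrite (@lin_swr _ _ H _ _ (fun x : M => cp (m * x) (q * a'))); last by lin.
by apply: eq_sw => r s; rewrite /F actionM.
Qed.

Lemma lin_crossed_mulr m a :
  lin (tlift (crossed_mul_pure m a) : X -> X).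
Proof.
apply: lin_tlift; first exact: crossed_mul_balancedr.
by rewrite /crossed_mul_pure => a'; lin.
Qed.

Lemma crossed_mul_balancedl u :
  balanced (AL_rel act) (fun m a => tlift (crossed_mul_pure m a) u).
Proof.
apply: balanced_bil.
  by split=> [a|m]; apply: lin_tliftr => m' a'; rewrite /crossed_mul_pure; lin.
move=> m _ _ a [l [lL -> ->]]; apply: eq_tlift => m' a'.
rewrite /crossed_mul_pure (sw_ALl _ lL); last by lin.
by apply: eq_sw => p q; rewrite actionM (act_AL _ lL) mulrA.
Qed.

Definition crossed_mul t u : X :=
  tlift (fun m a => tlift (crossed_mul_pure m a) u) t.

Lemma crossed_mulE m a m' a' :
  crossed_mul (cp m a) (cp m' a') = \sw_(p, q <- a) cp (m * act p m') (q * a').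
Proof.
rewrite /crossed_mul (tlift_pure _ _ (crossed_mul_balancedl _)).
exact: (tlift_pure _ _ (crossed_mul_balancedr _ _)).
Qed.

Lemma lin_crossed_mul_l u : lin (fun t => crossed_mul t u).
Proof.
apply: lin_tlift; first exact: crossed_mul_balancedl.
by move=> a; apply: lin_tliftr => m' a'; rewrite /crossed_mul_pure; lin.
Qed.

Lemma lin_crossed_mul_r t : lin (crossed_mul t).
Proof. by apply: lin_tliftr => m a; exact: lin_crossed_mulr. Qed.

Lemma crossed_ind (P : X -> Prop) :
  (forall t u, P t -> P u -> P (t + u)) -> (forall m a, P (cp m a)) ->
  forall t, P t.
Proof. exact: tensor_ind. Qed.

Lemma crossed_mulDl : left_distributive crossed_mul +%R.
Proof. by move=> t u v; rewrite (linD _ _ (lin_crossed_mul_l v)). Qed.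

Lemma crossed_mulDr : right_distributive crossed_mul +%R.
Proof. by move=> t u v; rewrite (linD _ _ (lin_crossed_mul_r t)). Qed.

Lemma crossed_mul_swl (f : A -> A -> X) a u :
  crossed_mul (sw H f a) u = \sw_(p, q <- a) crossed_mul (f p q) u.
Proof. exact: lin_swr (lin_crossed_mul_l u). Qed.

Lemma crossed_mul_swr (f : A -> A -> X) a t :
  crossed_mul t (sw H f a) = \sw_(p, q <- a) crossed_mul t (f p q).
Proof. exact: lin_swr (lin_crossed_mul_r t). Qed.

Lemma crossed_mulA : associative crossed_mul.
Proof.
move=> x y z; elim/crossed_ind: x => [x x' IH IH'|m a].
  by rewrite !crossed_mulDl IH IH'.
elim/crossed_ind: y => [y y' IH IH'|m' a'].
  by rewrite crossed_mulDl !crossed_mulDr crossed_mulDl IH IH'.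
elim/crossed_ind: z => [z z' IH IH'|m'' a''].
  by rewrite !crossed_mulDr IH IH'.
rewrite !crossed_mulE crossed_mul_swr crossed_mul_swl.
transitivity (\sw_(b, c <- a') \sw_(p, q <- a) \sw_(r, s <- q)
    cp (m * (act p m' * act r (act b m''))) (s * (c * a''))).
  apply: eq_sw => b c; rewrite crossed_mulE -sw_assoc; last by lin.
  apply: eq_sw => p q; rewrite act_mul.
  by rewrite (@lin_swr _ _ H _ _ (fun x : M => cp (m * x) _)); last by lin.
rewrite sw_exchange; apply: eq_sw => p q.
rewrite crossed_mulE sw_mul; last by lin.
rewrite sw_exchange; apply: eq_sw => r s; apply: eq_sw => b c.
by rewrite actionM !mulrA.
Qed.

Lemma crossed_mul_cp1 m m' a : crossed_mul (cp m 1) (cp m' a) = cp (m * m') a.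
Proof.
rewrite crossed_mulE.
(* The leg 1_(2) lies in A_L and moves into M as 1_(2) |> 1; then Delta(1) acts trivially on the
   product of m' and 1. *)
transitivity (\sw_(p, q <- 1) cp (m * (act p m' * act q 1)) a).
  apply: sw1_AL; [by lin | by lin |] => p l lL.
  by rewrite cp_AL // mulrA.
rewrite -(@lin_swr _ _ H _ _ (fun x : M => cp (m * x) a)); last by lin.
by rewrite sw1_act mulr1.
Qed.

Lemma crossed_mul_1cp m a b : crossed_mul (cp m a) (cp 1 b) = cp m (a * b).
Proof. by rewrite crossed_mulE sw_cp_act. Qed.

Lemma crossed_mul1l : left_id (cp 1 1) crossed_mul.
Proof.
move=> t; elim/crossed_ind: t => [t u IHt IHu|m a].
  by rewrite crossed_mulDr IHt IHu.
by rewrite crossed_mul_cp1 mul1r.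
Qed.

Lemma crossed_mul1r : right_id (cp 1 1) crossed_mul.
Proof.
move=> t; elim/crossed_ind: t => [t u IHt IHu|m a].
  by rewrite crossed_mulDl IHt IHu.
by rewrite crossed_mul_1cp mulr1.
Qed.

Definition crossed_star_pure m a : X :=
  \sw_(p, q <- star a) cp (act p (star m)) q.

Lemma crossed_star_pureZl c m a :
  crossed_star_pure (c *: m) a = c^* *: crossed_star_pure m a.
Proof.
rewrite /crossed_star_pure starZ.
by rewrite (@linZ _ _ _ (fun n => \sw_(p, q <- star a) cp (act p n) q)); last by lin.
Qed.

Lemma crossed_star_pure_AL m l a : AL H l ->
  crossed_star_pure m (l * a) = crossed_star_pure (m * act l 1) a.
Proof.
move=> lL; rewrite /crossed_star_pure starM (sw_ALr _ (AL_star lL)); last by lin.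
apply: eq_sw => p q.
by rewrite actionM (act_AL _ (AL_star lL)) starM star_act_AL.
Qed.

Lemma crossed_star_balanced : balanced (AL_rel act) crossed_star_pure.
Proof.
split=> [m n a|m a b|c m a|c m _ _ a [l [lL -> ->]]].
- rewrite /crossed_star_pure starD.
  by rewrite (@linD _ _ _ (fun n => \sw_(p, q <- star a) cp (act p n) q)); last by lin.
- rewrite /crossed_star_pure starD.
  by rewrite (@linD _ _ _ (sw H (fun p q => cp (act p (star m)) q))); last by lin.
- rewrite crossed_star_pureZl /crossed_star_pure starZ.
  by rewrite (@linZ _ _ _ (sw H (fun p q => cp (act p (star m)) q))); last by lin.
- by rewrite crossed_star_pure_AL // -sa_scalerAl.
Qed.

Definition crossed_star t : X := tlift crossed_star_pure t.

Lemma crossed_starE m a :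
  crossed_star (cp m a) = \sw_(p, q <- star a) cp (act p (star m)) q.
Proof. exact: tlift_pure crossed_star_balanced. Qed.

Lemma crossed_starD : {morph crossed_star : t u / t + u}.
Proof. by move=> t u; apply: tliftD crossed_star_balanced. Qed.

Lemma crossed_starZ c t : crossed_star (c *: t) = c^* *: crossed_star t.
Proof.
rewrite /crossed_star (tliftZ _ _ crossed_star_balanced) !tliftE scaler_sumr.
by apply: eq_bigr => z _; exact: crossed_star_pureZl.
Qed.

Lemma crossed_star_sw (f : A -> A -> X) a :
  crossed_star (sw H f a) = \sw_(p, q <- a) crossed_star (f p q).
Proof.
apply: sw_morph; last exact: crossed_starD.
exact: tlift0 crossed_star_balanced.
Qed.

Lemma crossed_star_mulE m a :
  crossed_star (cp m a) = crossed_mul (cp 1 (star a)) (cp (star m) 1).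
Proof.
rewrite crossed_starE crossed_mulE; apply: eq_sw => p q.
by rewrite mul1r mulr1.
Qed.

Local Notation S' x := (star (S (star x))).

(** The product a_(2) S'(a_(1)) contracts to coeR(a_(1)) = e(1_(2) a_(1)) 1_(1). Since 1_(2) is in
    A_L, it can be moved onto the first leg of the remaining coproduct, and the counit then
    disappears. *)
Lemma sw_costar_mid {U : lmodType C} (F : A -> A -> A -> U) a : tri F ->
  \sw_(p, q <- a) \sw_(u, v <- q) \sw_(r, s <- u) F (r * S' p) s v =
  \sw_(b, c <- 1) \sw_(r, s <- a) F b (c * r) s.
Proof.
move=> FT; have [F1 F2 F3] := FT.
transitivity (\sw_(y, z <- a) \sw_(p, r <- y) \sw_(s, v <- z) F (r * S' p) s v).
  rewrite sw_assoc; last first.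
    split=> [r z|p z|p r].
    + apply: lin_sw => s v; apply: (lin_comp (F1 s v)).
      by apply: lin_mull; exact: lin_costar.
    + by apply: lin_sw => s v; apply: (lin_comp (F1 s v)); lin.
    + by apply: lin_sw_arg.
  apply: eq_sw => p q; rewrite (sw_assoc H q (F := fun r s v => F (r * S' p) s v)) //.
  by split=> *; [apply: (lin_comp (F1 _ _)); lin | exact: F2 | exact: F3].
transitivity (\sw_(y, z <- a) \sw_(b, c <- 1)
    (e (c * y) *: \sw_(s, v <- z) F b s v)).
  apply: eq_sw => y z.
  have FL : lin (fun x => \sw_(s, v <- z) F x s v).
    by apply: lin_sw => s v; exact: F1.
  rewrite -(lin_swr _ _ _ FL) sw_mul_costar (lin_swr _ _ _ FL).
  by apply: eq_sw => b c; rewrite (linZ _ _ FL).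
have FB b : bil (F b) by split=> ?; [exact: F2 | exact: F3].
rewrite sw_exchange; apply: sw1_AL => [||b l lL].
- by lin; exact: F1.
- by split=> [c|b]; apply: lin_sw => r s; [exact: F1 | apply: (lin_comp (F2 b s)); lin].
rewrite -(sw_ALl a lL (f := fun y z => e y *: \sw_(s, v <- z) F b s v)); last by lin.
by rewrite sw_counitl; [exact: sw_ALl | lin].
Qed.

(** With c = star a, the factor star (a_(1) |> m') is S'(c_(1)) |> star m'. Letting the other legs
    of c act on its product with star m produces c_(2) S'(c_(1)), which [sw_costar_mid] reduces to a
    leg of Delta(1). *)
Lemma crossed_starM t u :
  crossed_star (crossed_mul t u) = crossed_mul (crossed_star u) (crossed_star t).
Proof.
elim/crossed_ind: t => [t t' IH IH'|m a].
  by rewrite crossed_mulDl !crossed_starD crossed_mulDr IH IH'.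
elim/crossed_ind: u => [u u' IH IH'|m' a'].
  by rewrite crossed_mulDr !crossed_starD crossed_mulDl IH IH'.
rewrite crossed_mulE crossed_star_sw !crossed_starE.
set n := star m'; set k := star m; set c := star a; set c' := star a'.
transitivity (\sw_(p, q <- c) \sw_(x, v <- c' * q)
                cp (act x (act (S' p) n * k)) v).
  rewrite /c sw_star; last first.
    by split=> *; [apply: lin_sw => * ; lin; exact: lin_costar | lin].
  apply: eq_sw => p q; rewrite crossed_starE !starM !starK; apply: eq_sw => x v.
  by rewrite action_star.
pose F y s v : X := \sw_(b, d <- c') cp (act b (act y n * act s k)) (d * v).
have FT : tri F by rewrite /F; lin.
transitivity (\sw_(p, q <- c) \sw_(x, v <- q) \sw_(r, s <- x) F (r * S' p) s v).
  apply: eq_sw => p q; rewrite sw_mul; last by lin.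
  rewrite sw_exchange; apply: eq_sw => x v; rewrite /F sw_exchange.
  apply: eq_sw => b d; rewrite actionM (act_mul x).
  rewrite (@lin_swr _ _ H _ _ (fun y : M => cp (act b y) (d * v))); last by lin.
  by apply: eq_sw => r s; rewrite actionM.
rewrite sw_costar_mid // crossed_mul_swl.
transitivity (\sw_(s, v <- c) \sw_(b, d <- c') cp (act b (n * act s k)) (d * v)).
  rewrite sw_exchange; apply: eq_sw => s v; rewrite /F sw_exchange.
  apply: eq_sw => b d; rewrite -sw1_act.
  rewrite (@lin_swr _ _ H _ _ (fun y : M => cp (act b y) (d * v))); last by lin.
  by apply: eq_sw => x y; rewrite actionM.
transitivity (\sw_(s, v <- c) \sw_(b, d <- c') \sw_(x, y <- d)
                cp (act b n * act x (act s k)) (y * v)).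
  apply: eq_sw => s v; rewrite -sw_assoc; last by lin.
  apply: eq_sw => b d; rewrite act_mul.
  by rewrite (@lin_swr _ _ H _ _ (fun y : M => cp y (d * v))); last by lin.
rewrite sw_exchange; apply: eq_sw => b d; rewrite crossed_mul_swr.
by apply: eq_sw => s v; rewrite crossed_mulE.
Qed.

Lemma crossed_star_1cp a : crossed_star (cp 1 a) = cp 1 (star a).
Proof.
rewrite crossed_starE star1 -[star a in RHS]mulr1 -sw_cp_act.
by apply: eq_sw => p q; rewrite mul1r mulr1.
Qed.

Lemma crossed_star_cp1 m : crossed_star (cp m 1) = cp (star m) 1.
Proof. by rewrite crossed_star_mulE star1 crossed_mul1l. Qed.

Lemma crossed_starK : involutive crossed_star.
Proof.
move=> t; elim/crossed_ind: t => [t u IHt IHu|m a].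
  by rewrite !crossed_starD IHt IHu.
rewrite crossed_star_mulE crossed_starM crossed_star_cp1 crossed_star_1cp !starK.
by rewrite crossed_mul_cp1 mulr1.
Qed.

Lemma crossed_star_algebra :
  star_algebra_axioms crossed_mul (cp 1 1) crossed_star.
Proof.
split.
- exact: crossed_mulA.
- exact: crossed_mul1l.
- exact: crossed_mul1r.
- exact: crossed_mulDl.
- exact: crossed_mulDr.
- by move=> c t u; rewrite (linZ _ _ (lin_crossed_mul_l u)).
- by move=> c t u; rewrite (linZ _ _ (lin_crossed_mul_r t)).
- exact: crossed_starD.
- exact: crossed_starZ.
- exact: crossed_starM.
- exact: crossed_starK.
Qed.

End Crossed.

(** * The copies of M and A, commutants and center *)

Section CrossedAlgebra.
Context {C : numClosedFieldType} {A : finCstarAlg C} {H : weakHopf A}.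
Context {M : starAlg C} (act : moduleAlg H M).
Local Notation "\sw_ ( a , b <- x ) F" := (sw H (fun a b => F) x).
Local Notation S := (antipode H).
Local Notation eL := (eL H).
Implicit Types (a b l r : A) (m n : M).

Definition crossed_alg : starAlg C := StarAlg (crossed_star_algebra act).

Local Notation X := crossed_alg.

Definition cpX m a : X := crossed_pure act m a.
Local Notation cp := cpX.
Definition iM m : X := cp m 1.
Definition iA a : X := cp 1 a.

Lemma cp_mul m a m' a' :
  cp m a * cp m' a' = \sw_(p, q <- a) cp (m * act p m') (q * a').
Proof. exact: crossed_mulE. Qed.

Lemma cp_mul_iA m a b : cp m a * iA b = cp m (a * b).
Proof. exact: crossed_mul_1cp. Qed.

Lemma iM_mul_cp m m' a : iM m * cp m' a = cp (m * m') a.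
Proof. exact: crossed_mul_cp1. Qed.

Lemma iM_iA m a : iM m * iA a = cp m a.
Proof. by rewrite iM_mul_cp mulr1. Qed.

Lemma cp_ind (P : X -> Prop) :
  (forall t u, P t -> P u -> P (t + u)) -> (forall m a, P (cp m a)) ->
  forall t, P t.
Proof. exact: crossed_ind. Qed.

Lemma iA_iM m a : iA a * iM m = \sw_(p, q <- a) cp (act p m) q.
Proof. by rewrite cp_mul; apply: eq_sw => p q; rewrite mul1r mulr1. Qed.

(** Writing m as m 1 gives (a_(1) |> m)(a_(2) |> 1) # 1 = (a_(1) |> m) # eL(a_(2)), and eL(a_(2)) =
    a_(2) S(a_(3)). *)
Lemma cp_act m a : cp (act a m) 1 =
  \sw_(a1, a2 <- a) (iA a1 * iM m * iA (S a2)).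
Proof.
transitivity (\sw_(p, q <- a) \sw_(r, s <- q) cp (act p m) (r * S s)).
  rewrite -[m in LHS]mulr1 act_mul.
  rewrite (@lin_swr _ _ H _ _ (fun y : M => cp y 1)); last exact: lin_cpl lin_id.
  apply: eq_sw => p q.
  rewrite -act_eL -(@lin_swr _ _ H _ _ (cp (act p m))); last exact: lin_cpr lin_id.
  by rewrite sw_mulS -[eL q in RHS]mulr1 [RHS]cp_AL //; exact: AL_eL.
rewrite -sw_assoc; last by rewrite /cpX; lin.
apply: eq_sw => p q; rewrite iA_iM.
rewrite (@lin_swr _ _ H _ _ (fun t : X => t * iA (S q))); last first.
  by move=> c t u; rewrite mulrDl sa_scalerAl.
by apply: eq_sw => r s; rewrite cp_mul_iA.
Qed.

Lemma iM_hom : unital_star_hom iM.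
Proof.
split=> //.
- exact: lin_cpl lin_id.
- by move=> m n; rewrite iM_mul_cp.
- by move=> m; rewrite [RHS]crossed_star_cp1.
Qed.

Lemma iA_hom : unital_star_hom iA.
Proof.
split=> //.
- exact: lin_cpr lin_id.
- by move=> a b; rewrite cp_mul_iA.
- by move=> a; rewrite [RHS]crossed_star_1cp.
Qed.

Lemma iM_inj : injective iM.
Proof.
have EB : balanced (AL_rel act) (fun m a => m * act a 1).
  apply: balanced_bil; first by lin.
  by move=> m _ _ a [l [lL -> ->]]; rewrite actionM (act_AL _ _ lL) mulrA.
move=> m n /(congr1 (tlift (fun m a => m * act a 1))).
by rewrite !(tlift_pure _ _ EB) !action1 !mulr1.
Qed.

Lemma iA_AL l : AL H l -> iA l = iM (act l 1).
Proof.
by move=> lL; rewrite -[l in LHS]mulr1 [LHS]cp_AL // mul1r.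
Qed.

Lemma fixed_pointsP n :
  fixed_points act n <-> forall a, act a n = act (eL a) n.
Proof. by split=> nF a; have := nF a; rewrite /mul_antipode -/(sw H _ a) sw_mulS. Qed.

Lemma act_fixed n a : fixed_points act n -> act a n = n * act a 1.
Proof.
move=> /fixed_pointsP nF; rewrite nF -act_eL.
(* The preimage of eL(a) under S, an element of A_R. As n is fixed, a may be replaced by [r], and
   A_R acts by right multiplication. *)
pose r := star (S (star (eL a))).
have rR : AR H r by apply/AR_star/AR_antipode/AL_star/AL_eL.
have <- : eL r = eL a by rewrite -antipode_AR // antipode_costar.
by rewrite -nF (act_AR _ _ rR) act_eL.
Qed.

Lemma iA_fixed a n : fixed_points act n -> iA a * iM n = iM n * iA a.
Proof.
move=> nF; rewrite iM_iA iA_iM -[a in RHS]mulr1 -[RHS]sw_cp_act.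
by apply: eq_sw => p q; rewrite act_fixed // mulr1.
Qed.

Lemma iA_AR r m : AR H r -> iA r * iM m = iM m * iA r.
Proof.
move=> rR; rewrite iM_iA iA_iM (sw_AR' rR); last by rewrite /cpX; lin.
rewrite -[RHS]mul1r cp_mul.
by apply: eq_sw => p q; rewrite mul1r.
Qed.

Lemma centerP (t : X) : center X t <->
  (forall m, t * iM m = iM m * t) /\ (forall a, t * iA a = iA a * t).
Proof.
split=> [tZ|[tM tA] u]; first by split=> ?; apply: tZ.
elim/cp_ind: u => [u v IHu IHv|m a]; first by rewrite mulrDr mulrDl IHu IHv.
by rewrite -iM_iA mulrA tM -mulrA tA mulrA.
Qed.

Lemma iM_center m : center X (iM m) <-> fixed_points act m /\ center M m.
Proof.
split=> [mZ|[mF mZ]].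
  split=> [|n]; last first.
    by apply: iM_inj; rewrite !(ush_mul iM_hom); exact: mZ.
  (* Centrality pulls m out of a_(1) m S(a_(2)) and leaves m eL(a). So a |> m depends on a only
     through eL(a), and eL is idempotent. *)
  have E a : act a m = m * act (eL a) 1.
    apply: iM_inj; rewrite [LHS]cp_act.
    transitivity (iM m * iA (eL a)); last first.
      by rewrite (ush_mul iM_hom) iA_AL //; exact: AL_eL.
    rewrite -sw_mulS (@lin_swr _ _ H _ _ (fun b => iM m * iA b)); last first.
      by apply: lin_mull; exact: lin_cpr lin_id.
    apply: eq_sw => p q; rewrite -(mZ (iA p)) -mulrA -(ush_mul iA_hom).
    by [].
  by apply/fixed_pointsP => a; rewrite !E eL_eL.
apply/centerP; split=> [n|a]; last by rewrite iA_fixed.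
by rewrite -!(ush_mul iM_hom) (mZ n).
Qed.

Lemma crossed_commutants :
  [/\ range iA `<=` commutant (iM @` fixed_points act),
      iA @` AR H `<=` commutant (range iM),
      iA @` (AR H `&` center A) `<=` center X
    & iA @` (AL H `&` AR H `&` center A) `<=` range iM `&` center X].
Proof.
have ZR r : AR H r -> center A r -> center X (iA r).
  move=> rR rZ; apply/centerP; split=> [m|a]; first exact: iA_AR.
  by rewrite -!(ush_mul iA_hom) (rZ a).
split.
- by move=> _ [a _ <-] _ [n nF <-]; exact: iA_fixed.
- by move=> _ [r rR <-] _ [m _ <-]; exact: iA_AR.
- by move=> _ [r [rR rZ] <-]; exact: ZR.
- move=> _ [l [[lL lR] lZ] <-]; split; last exact: ZR.
  by rewrite iA_AL //; exists (act l 1).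
Qed.

Lemma crossed_center :
  range iM `&` center X = iM @` (fixed_points act `&` center M) /\
  iM @` (fixed_points act `&` center M) =
    (iM @` fixed_points act) `&` center X.
Proof.
split; apply/seteqP; split.
- by move=> _ [[m _ <-] /iM_center mZ]; exists m.
- by move=> _ [m /iM_center mZ <-]; split=> //; exists m.
- by move=> _ [m mFZ <-]; split; [exists m => //; case: mFZ | apply/iM_center].
- by move=> _ [[m mF <-] /iM_center mZ]; exists m.
Qed.

End CrossedAlgebra.

(** * Tensor product and quotient descriptions of the two subalgebras *)

Lemma star_algebra_inj {C : numClosedFieldType} (V : lmodType C) (X : starAlg C)
    (f : V -> X) (mul : V -> V -> V) (one : V) (conj : V -> V) :
  lin f -> injective f -> (forall x y, f (mul x y) = f x * f y) -> f one = 1 ->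
  (forall x, f (conj x) = star (f x)) -> star_algebra_axioms mul one conj.
Proof.
move=> fL fI fM f1 fS; have fD x y := linD x y fL.
split=> [x y z|x|x|x y z|x y z|c x y|c x y|x y|c x|x y|x]; apply: fI.
- by rewrite !fM mulrA.
- by rewrite fM f1 mul1r.
- by rewrite fM f1 mulr1.
- by rewrite !(fM, fD) mulrDl.
- by rewrite !(fM, fD) mulrDr.
- by rewrite fM !(linZ _ _ fL) fM sa_scalerAl.
- by rewrite fM !(linZ _ _ fL) fM sa_scalerAr.
- by rewrite !(fS, fD) starD.
- by rewrite fS !(linZ _ _ fL) fS starZ.
- by rewrite !(fM, fS) starM.
- by rewrite !fS starK.
Qed.

Lemma lin_injective {K : nzRingType} {U V : lmodType K} (f : U -> V) :
  lin f -> (forall x, f x = 0 -> x = 0) -> injective f.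
Proof.
move=> fL f0 x y fxy; apply/eqP; rewrite -subr_eq0; apply/eqP/f0.
by rewrite addrC -scaleN1r fL fxy scaleN1r addNr.
Qed.

Definition linear_of {K : nzRingType} {U V : lmodType K} (f : U -> V)
    (fL : lin f) : {linear U -> V} :=
  HB.pack f (GRing.isLinear.Build K U V *:%R f fL).

Section CrossedIso.
Context {C : numClosedFieldType} {A : finCstarAlg C} {H : weakHopf A}.
Context {M : starAlg C} (act : moduleAlg H M).
Local Notation "\sw_ ( a , b <- x ) F" := (sw H (fun a b => F) x).
Local Notation S := (antipode H).
Local Notation eL := (eL H).
Local Notation X := (crossed_alg act).
Local Notation cp := (cpX act).
Local Notation iM := (iM act).
Local Notation iA := (iA act).
Implicit Types (a b l r : A) (m n : M).

Lemma lin_val {V : lmodType C} (I : submodClosed V) :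
  lin (val : subspace I -> V).
Proof. by move=> c x y; rewrite linearP. Qed.

(** Sliding A_L to the left, every element becomes a pure tensor with right factor 1, so injectivity
    reduces to [iM_inj]. *)
Lemma tensor_M_AL_iso : exists j : {linear tensor_M_AL act -> crossed act},
  [/\ forall m (x : subspace (AL_pred H)),
        j (tensor_M_AL_pure act m x) = cp m (val x),
      injective j & range j = range iM].
Proof.
pose f m (x : subspace (AL_pred H)) : crossed act := crossed_pure act m (val x).
have fB : bil f.
  split=> [x|m]; first exact: lin_cpl lin_id.
  by apply: lin_cpr; exact: lin_val.
have fP : balanced (fun m (x : subspace (AL_pred H)) m' x' =>
            AL_rel act m (val x) m' (val x')) f.
  by apply: balanced_bil => // m x m' x'; exact: tpureG.
have jL : lin (tlift f : tensor_M_AL act -> crossed act).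
  by apply: lin_tlift => //; case: fB.
have jE m x : tlift f (tensor_M_AL_pure act m x) = f m x := tlift_pure _ _ fP.
have AL1P : 1 \in AL_pred H by exact/asboolP/AL1.
pose one : subspace (AL_pred H) := Sub 1 AL1P.
have tE t : exists m, t = tensor_M_AL_pure act m one.
  move: t; apply: tensor_ind => [_ _ [m ->] [n ->]|m x].
    by exists (m + n); rewrite /tensor_M_AL_pure tpureDl.
  exists (m * act (val x) 1); apply: tpureG; exists (val x); split=> //.
    exact/asboolP/(valP x).
  by rewrite mulr1.
exists (linear_of jL); split=> //.
- move=> t u; have [m ->] := tE t; have [n ->] := tE u.
  by rewrite /= !jE => /(@iM_inj _ _ _ _ act) ->.
- apply/seteqP; split=> [_ [t _ <-]|_ [m _ <-]].
    by have [m ->] := tE t; exists m => //=; rewrite jE.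
  by exists (tensor_M_AL_pure act m one) => //=; rewrite jE.
Qed.

(* The [phi]-component of m # a |-> m (S(1_(1)) |> 1) (x) 1_(2) a in M (x) A.  *)
Definition coef_map (phi : {scalar A}) m a : M :=
  \sw_(p, q <- 1) (phi (q * a) *: (m * act (S p) 1)).

(** Compatibility with A_L is the separability property [sw1_antipode_AL]. *)
Lemma coef_map_balanced phi : balanced (AL_rel act) (coef_map phi).
Proof.
apply: balanced_bil; first by rewrite /coef_map; lin.
move=> m _ _ a [l [lL -> ->]].
transitivity (\sw_(p, q <- 1) (phi (q * a) *: (m * act (l * S p) 1))).
  rewrite (@sw1_antipode_AL _ _ _ _
    (fun u q => phi (q * a) *: (m * act u 1)) _ lL); last by lin.
  by apply: eq_sw => p q; rewrite mulrA.
by apply: eq_sw => p q; rewrite actionM (act_AL _ _ lL) mulrA.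
Qed.

Lemma iA_eq0 a : iA a = 0 ->
  exists (k : nat) (b c : 'I_k -> A), (forall i, ker_mu act (b i)) /\
    a = \sum_(i < k) b i * c i.
Proof.
move=> a0; have [n [phi [c cE]]] := @findim_basis _ A.
(* From S(1_(1)) 1_(2) = eR(1) = 1 one gets a = S(1_(1)) 1_(2) a; these are the left factors when
   1_(2) a is expanded in the [c i]. The map [coef_map (phi i)] sends 1 # a = 0 to b_i |> 1, which
   therefore vanishes. *)
pose b i := \sw_(p, q <- 1) (phi i (q * a) *: S p).
exists n, b, c; split=> [i|].
  split.
    have psiP : scalar (fun q : A => phi i (q * a)).
      by move=> k x y; rewrite mulrDl -sa_scalerAl linearP.
    pose r := \sw_(p, q <- 1) (phi i (q * a) *: p).
    have -> : b i = S r.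
      rewrite (@lin_swr _ _ H _ _ S); last exact: lin_antipode.
      by apply: eq_sw => p q; rewrite linearZ.
    by apply: AL_antipode; exists (scalar_of psiP).
  have /(congr1 (tlift (coef_map (phi i)))) := a0.
  rewrite (tlift0 (coef_map_balanced _)) (tlift_pure _ _ (coef_map_balanced _)).
  move=> <-; rewrite (@lin_swr _ _ H _ _ (fun x : A => act x 1)); last by lin.
  apply: eq_sw => p q.
  by rewrite mul1r (@linZ _ _ _ (fun x : A => act x 1)); last by lin.
rewrite -[LHS]mul1r -(eR1 H) -sw_Smul.
rewrite (@lin_swr _ _ H _ _ (fun x : A => x * a)); last by lin.
transitivity (\sum_(i < n) \sw_(p, q <- 1) (phi i (q * a) *: (S p * c i))).
  under [RHS]eq_bigr do rewrite swE.
  rewrite exchange_big swE; apply: eq_bigr => z _ /=.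
  rewrite -mulrA {1}[z.2 * a]cE mulr_sumr; apply: eq_bigr => i _.
  by rewrite -sa_scalerAr.
apply: eq_bigr => i _.
rewrite (@lin_swr _ _ H _ _ (fun x : A => x * c i)); last by lin.
by apply: eq_sw => p q; rewrite sa_scalerAl.
Qed.

Lemma MR1 : 1 \in MR_pred act.
Proof. by apply/asboolP; exists 1; rewrite action1. Qed.

(** An element y |> 1 = eL(y) |> 1 of M_R crosses the tensor sign, so every tensor is 1 ⊗ a. If 1 #
    a = 0, then by [iA_eq0] it is a sum of terms (b_i |> 1) ⊗ c_i, all zero. *)
Lemma tensor_MR_A_iso : exists k : {linear tensor_MR_A act -> crossed act},
  [/\ forall (x : subspace (MR_pred act)) a,
        k (tensor_MR_A_pure x a) = cp (val x) a,
      injective k & range k = range iA].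
Proof.
pose f (x : subspace (MR_pred act)) a : crossed act := crossed_pure act (val x) a.
have fB : bil f.
  split=> [a|x]; last exact: lin_cpr lin_id.
  by apply: lin_cpl; exact: lin_val.
have fP : balanced (fun (x : subspace (MR_pred act)) a x' a' =>
            AL_rel act (val x) a (val x') a') f.
  by apply: balanced_bil => // x a x' a'; exact: tpureG.
have kL : lin (tlift f : tensor_MR_A act -> crossed act).
  by apply: lin_tlift => //; case: fB.
have kE x a : tlift f (tensor_MR_A_pure x a) = f x a := tlift_pure _ _ fP.
pose one : subspace (MR_pred act) := Sub 1 MR1.
have tE t : exists a, t = tensor_MR_A_pure one a.
  move: t; apply: tensor_ind => [_ _ [a ->] [b ->]|x a].
    by exists (a + b); rewrite /tensor_MR_A_pure tpureDr.
  have /asboolP [y xE] := valP x.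
  exists (eL y * a); symmetry; apply: tpureG; exists (eL y); split=> //.
    exact: AL_eL.
  by rewrite mul1r act_eL.
exists (linear_of kL); split=> //.
- apply: lin_injective => // t; have [a ->] := tE t.
  rewrite /= kE => /iA_eq0 [n [b [c [bK ->]]]].
  rewrite /tensor_MR_A_pure (lin_sum _ _ _ (bil_tpure.2 one)); apply: big1 => i _.
  have [bL b1] := bK i.
  transitivity (tensor_MR_A_pure (0 : subspace (MR_pred act)) (c i)).
    by apply: tpureG; exists (b i); split=> //; rewrite b1 mulr0.
  exact: (lin0 (bil_tpure.1 (c i))).
- apply/seteqP; split=> [_ [t _ <-]|_ [a _ <-]].
    by have [a ->] := tE t; exists a => //=; rewrite kE.
  by exists (tensor_MR_A_pure one a) => //=; rewrite kE.
Qed.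

Lemma ideal_gen_ideal (J0 : set A) : two_sided_ideal (ideal_gen J0).
Proof.
split=> [|x y xJ yJ|c x xJ|x y yJ|x y xJ] J JI SJ.
- exact: ideal0.
- by apply: idealD => //; [exact: xJ | exact: yJ].
- by apply: idealZ => //; exact: xJ.
- by apply: idealMl => //; exact: yJ.
- by apply: Defs.idealMr => //; exact: xJ.
Qed.

Lemma ideal_gen_sub (J0 : set A) : J0 `<=` ideal_gen J0.
Proof. by move=> x xS J JI SJ; exact: SJ. Qed.

(** The kernel of [iA] is an ideal, and it contains the kernel of mu because 1 # l = (l |> 1) # 1 on
    A_L. The converse is the expansion in [iA_eq0]. *)
Lemma ideal_gen_ker a : ideal_gen (ker_mu act) a <-> iA a = 0.
Proof.
have iAL := ush_linear (iA_hom act).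
split=> [aI|/iA_eq0 [n [b [c [bK ->]]]]]; last first.
  have JI := ideal_gen_ideal (ker_mu act).
  elim/big_ind: _ => [||i _]; [exact: ideal0 | exact: idealD |].
  exact: (Defs.idealMr JI _ (ideal_gen_sub (bK i))).
apply: (aI (fun x => iA x = 0)); last first.
  by move=> b [bL b1]; rewrite iA_AL // b1; exact: (lin0 (ush_linear (iM_hom act))).
split=> [|x y x0 y0|c x x0|x y y0|x y x0].
- exact: (lin0 iAL).
- by rewrite (linD _ _ iAL) x0 y0 addr0.
- by rewrite (linZ _ _ iAL) x0 scaler0.
- by rewrite (ush_mul (iA_hom act)) y0 mulr0.
- by rewrite (ush_mul (iA_hom act)) x0 mul0r.
Qed.

Lemma A_mod_ker_iso :
  exists (mulQ : A_mod_ker act -> A_mod_ker act -> A_mod_ker act)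
    (oneQ : A_mod_ker act) (conjQ : A_mod_ker act -> A_mod_ker act)
    (axQ : star_algebra_axioms mulQ oneQ conjQ),
    let Q : starAlg C := StarAlg axQ in
    unital_star_hom (to_A_mod_ker act : A -> Q) /\
    exists f : Q -> X,
      [/\ forall a, f (to_A_mod_ker act a) = iA a,
          unital_star_hom f, injective f & range f = range iA].
Proof.
have iAL := ush_linear (iA_hom act).
(* Classes are separated exactly by [iA]. Hence [f] does not depend on the chosen representatives
   and is injective, and the star algebra axioms on the quotient are inherited from X along [f]. *)
have eqP a b : to_A_mod_ker act a = to_A_mod_ker act b <-> iA a = iA b.
  rewrite to_lquot_eq; split=> [/asboolP/ideal_gen_ker E|E].
    by rewrite -[a](subrK b) (linD _ _ iAL) E add0r.
  apply/asboolP/ideal_gen_ker.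
  by rewrite (linD _ _ iAL) E -(linD _ _ iAL) subrr (lin0 iAL).
pose rep (q : A_mod_ker act) : A :=
  repr (q : Quotient.quot (subspace_pred (ideal_gen_pred (ker_mu act)))).
have repK q : to_A_mod_ker act (rep q) = q by exact: to_lquotK.
pose f q : X := iA (rep q).
have fE a : f (to_A_mod_ker act a) = iA a by apply/eqP; rewrite repK.
have fL : lin f.
  move=> c p q; rewrite -[p]repK -[q]repK -linearP !fE; exact: iAL.
have fI : injective f by move=> p q /eqP; rewrite !repK.
pose mulQ p q := to_A_mod_ker act (rep p * rep q).
pose conjQ q := to_A_mod_ker act (star (rep q)).
have fM p q : f (mulQ p q) = f p * f q by rewrite fE (ush_mul (iA_hom act)).
have f1 : f (to_A_mod_ker act 1) = 1 by rewrite fE.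
have fS q : f (conjQ q) = star (f q) by rewrite fE (ush_star (iA_hom act)).
exists mulQ, (to_A_mod_ker act 1), conjQ, (star_algebra_inj fL fI fM f1 fS).
split.
  split=> //.
  - by move=> c a b; rewrite -[RHS]linearP.
  - by move=> a b; apply: (fI); rewrite [RHS]fM !fE (ush_mul (iA_hom act)).
  - by move=> a; apply: (fI); rewrite [RHS]fS !fE (ush_star (iA_hom act)).
exists f; split=> //.
apply/seteqP; split=> [_ [q _ <-]|_ [a _ <-]]; first by exists (rep q).
by exists (to_A_mod_ker act a) => //; exact: fE.
Qed.

End CrossedIso.

Theorem theorem3p1p1 (R : realType) (A : finCstarAlg R[i]) (H : weakHopf A)
    (M : starAlg R[i]) (act : moduleAlg H M) :
  exists (mul : crossed act -> crossed act -> crossed act) (one : crossed act)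
    (conj : crossed act -> crossed act)
    (ax : star_algebra_axioms mul one conj),
  let X : starAlg R[i] := StarAlg ax in
  let cp (m : M) (a : A) : X := crossed_pure act m a in
  let iM (m : M) : X := cp m 1 in
  let iA (a : A) : X := cp 1 a in
  [/\
    (* (i) *)
    (forall (m m' : M) (a a' : A), cp m a * cp m' a' =
       tlift (fun a1 a2 : A => cp (m * act a1 m') (a2 * a')) (comul H a))
    /\ (forall (m : M) (a : A), star (cp m a) = cp 1 (star a) * cp (star m) 1),
    (* (ii) *)
    forall (m : M) (a : A), cp (act a m) 1 =
      tlift (fun a1 a2 : A => cp 1 a1 * cp m 1 * cp 1 (antipode H a2))
        (comul H a),
    (* (iii) *)
    [/\ (1 : X) = cp 1 1,
      unital_star_hom iM /\ injective iM,
      exists j : {linear tensor_M_AL act -> crossed act},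
        [/\ forall (m : M) (x : subspace (AL_pred H)),
              j (tensor_M_AL_pure act m x) = cp m (val x),
            injective j & range j = range iM],
      exists (mulQ : A_mod_ker act -> A_mod_ker act -> A_mod_ker act)
        (oneQ : A_mod_ker act) (conjQ : A_mod_ker act -> A_mod_ker act)
        (axQ : star_algebra_axioms mulQ oneQ conjQ),
        let Q : starAlg R[i] := StarAlg axQ in
        unital_star_hom (to_A_mod_ker act : A -> Q) /\
        exists f : Q -> X,
          [/\ forall a : A, f (to_A_mod_ker act a) = iA a,
              unital_star_hom f, injective f & range f = range iA]
      & exists k : {linear tensor_MR_A act -> crossed act},
        [/\ forall (x : subspace (MR_pred act)) (a : A),
              k (tensor_MR_A_pure x a) = cp (val x) a,
            injective k & range k = range iA]],
    (* (iv) *)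
    [/\ range iA `<=` commutant (iM @` fixed_points act),
        iA @` AR H `<=` commutant (range iM),
        iA @` (AR H `&` center A) `<=` center X
      & iA @` (AL H `&` AR H `&` center A) `<=` range iM `&` center X]
    (* (v) *)
  & range iM `&` center X = iM @` (fixed_points act `&` center M)
    /\ iM @` (fixed_points act `&` center M) =
       (iM @` fixed_points act) `&` center X].
Proof.
exists (@crossed_mul _ _ _ _ act), (crossed_pure act 1 1),
  (@crossed_star _ _ _ _ act), (crossed_star_algebra act) => X cp iM iA.
split.
- split=> [m m' a a'|m a]; first exact: cp_mul.
  exact: crossed_star_mulE.
- by move=> m a; exact: cp_act.
- split=> //.
  + by split; [exact: iM_hom | exact: iM_inj].
  + exact: tensor_M_AL_iso.
  + exact: A_mod_ker_iso.
  + exact: tensor_MR_A_iso.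
- exact: crossed_commutants.
- exact: crossed_center.
Qed.
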